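(* Let $\mathrm{ex}_3(n,BC_4)$ denote the maximum number of edges in a $3$-uniform hypergraph on $n$ vertices that contains no Berge cycle of length $4$. Then, as $n \to \infty$, \[ (1-o(1))\frac{n^{3/2}}{3\sqrt{3}} \le \mathrm{ex}_3(n,BC_4) \le (1+o(1))\frac{n^{3/2}}{\sqrt{10}}. \]
   Context: A hypergraph is $3$-uniform if all of its edges are $3$-element subsets of the vertex set. A Berge cycle of length $\ell$ in a hypergraph is a set of $\ell$ distinct vertices $\{v_1,\dots,v_\ell\}$ together with $\ell$ distinct edges $\{e_1,\dots,e_\ell\}$ such that $\{v_i,v_{i+1}\}\subseteq e_i$ for all $i$, with indices taken modulo $\ell$. *)

(* Defs.v *)
From mathcomp Require Import all_boot all_order all_algebra.
From mathcomp Require Import all_classical all_reals all_analysis.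

Set Implicit Arguments.
Unset Strict Implicit.
Unset Printing Implicit Defensive.

Definition uniform (T : finType) (r : nat) (H : {set {set T}}) : bool :=
  [forall e in H, #|e| == r].

(* [ordS i] is the cyclic successor of [i] in ['I_l]. *)
Definition has_Berge_cycle (T : finType) (l : nat) (H : {set {set T}}) : bool :=
  [exists v : {ffun 'I_l -> T}, exists e : {ffun 'I_l -> {set T}},
    [&& injectiveb v, injectiveb e,
        [forall i, e i \in H]
      & [forall i, [set v i; v (ordS i)] \subset e i]]].

Definition ex_Berge (r n l : nat) : nat :=
  \max_(H : {set {set 'I_n}} | uniform r H && ~~ has_Berge_cycle l H) #|H|.

(* Main.v *)
Require Import Defs.
From mathcomp Require Import all_boot all_order all_algebra finfield.
From mathcomp Require Import all_classical all_reals all_analysis.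
From mathcomp Require Import ring lra zify.
Set Implicit Arguments.
Unset Strict Implicit.
Unset Printing Implicit Defensive.
Import Order.TTheory GRing.Theory Num.Theory.
Import numFieldNormedType.Exports.

(** Upper bound.  Let D v be the degree of v in the shadow graph and d v its degree in H.  Counting
    2-paths u - v - w of the shadow, a pair {u, w} is joined by at most one of them, except for
    O(#|H|) pairs and for the pairs of pages of a common "book" {a, b, u}, {a, b, w}, which are
    joined by two; there are at most (1/4) sum_v d v (d v - 1) such pairs.  Hence
    sum_v (D v ^ 2 - d v ^ 2 / 2) <= n ^ 2 + O(#|H|).  A discharging of pairs to edges gives d <= D
    pointwise and sum_v D v >= 4 #|H|, and since 8 D ^ 2 - 4 d ^ 2 >= (3 D - d) ^ 2 whenever
    d <= D <= 2 d, Cauchy-Schwarz yields 81 #|H| ^ 2 <= 8 n ^ 3 + O(n #|H|), with 8 / 81 < 1 / 10.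

    Lower bound.  Doubling the points of the affine plane over the field with q elements gives
    q ^ 3 edges on 3 q ^ 2 vertices.  To reach every n one needs a prime power in (x, (1 + c) x]
    for large x.  This is Erdos's argument from Selberg's formula
    psi(x) ln x + sum_(n <= x) Lambda(n) psi(x / n) = 2 x ln x + O(x).  By this formula psi has
    density at most 2 on every interval, and a gap (x, r x] forces density 2 on (x / n, r x / n] for
    most prime powers n.  Taking r essentially maximal, such n occur in every interval (y, r' y]
    with r' slightly larger than r, so these blocks cover almost all of a long interval (M, A M],
    contradicting psi(s) <= 1.6 s + O(1). *)

(** * Double counting with 0/1 sums *)

Lemma exists_le_sum (I : finType) (A P : pred I) :
  [exists i, A i && P i] <= \sum_(i | A i) P i.
Proof.
case: existsP => //= -[i /andP[Ai Pi]].
by rewrite (bigD1 i) //= Pi leq_addr.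
Qed.

Lemma exists_le_sumT (I : finType) (P : pred I) : [exists i, P i] <= \sum_i P i.
Proof. by case: existsP => //= -[i Pi]; rewrite (bigD1 i) //= Pi leq_addr. Qed.

Lemma sum_mem_card (I : finType) (A : {set I}) : \sum_i (i \in A) = #|A|.
Proof. by rewrite -sum1_card [RHS]big_mkcond; apply: eq_bigr => i _; case: (i \in A). Qed.

Lemma card_off_diagonal (I : finType) (A : {set I}) :
  \sum_i \sum_j ((i != j) && (i \in A) && (j \in A)) = #|A| * #|A|.-1.
Proof.
rewrite -sum_nat_const [RHS]big_mkcond; apply: eq_bigr => i _.
case: ifP => iA; last by rewrite big1 // => j _; rewrite andbF.
rewrite (cardsD1 i A) iA add1n /= -sum_mem_card; apply: eq_bigr => j _.
by rewrite !inE andbT eq_sym.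
Qed.

Lemma sum2D (I : finType) (F G : I -> I -> nat) :
  \sum_i \sum_j (F i j + G i j) = \sum_i \sum_j F i j + \sum_i \sum_j G i j.
Proof. by rewrite -big_split /=; apply: eq_bigr => i _; rewrite big_split. Qed.

Lemma sum2M (I : finType) k (F : I -> I -> nat) :
  \sum_i \sum_j (F i j * k) = (\sum_i \sum_j F i j) * k.
Proof. by rewrite big_distrl /=; apply: eq_bigr => i _; rewrite big_distrl. Qed.

(** * The upper bound *)

Section BergeC4Free.
Variables (T : finType) (H : {set {set T}}).
Hypothesis H3 : uniform 3 H.
Hypothesis noC : ~~ has_Berge_cycle 4 H.
Implicit Types (a b c u v w x y z : T) (e f h : {set T}).

Lemma edge_card h : h \in H -> #|h| = 3.
Proof. by move=> hH; apply/eqP; move/forallP: H3 => /(_ h); rewrite hH. Qed.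

(** Hides the finite-function encoding of cycles: later arguments only name four vertices and four
    edges. *)
Lemma no_Berge_C4 a b c d e1 e2 e3 e4 :
  uniq [:: a; b; c; d] -> uniq [:: e1; e2; e3; e4] ->
  e1 \in H -> e2 \in H -> e3 \in H -> e4 \in H ->
  a \in e1 -> b \in e1 -> b \in e2 -> c \in e2 ->
  c \in e3 -> d \in e3 -> d \in e4 -> a \in e4 -> False.
Proof.
move=> u1 u2 H1 H2 H3' H4 ae be be2 ce2 ce3 de3 de4 ae4.
move/negP: noC; apply; apply/existsP.
exists [ffun i : 'I_4 => nth a [:: a; b; c; d] i]; apply/existsP.
exists [ffun i : 'I_4 => nth e1 [:: e1; e2; e3; e4] i].
apply/and4P; split.
- apply/injectiveP => i j; rewrite !ffunE => /eqP; rewrite nth_uniq //= => /eqP; exact: val_inj.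
- apply/injectiveP => i j; rewrite !ffunE => /eqP; rewrite nth_uniq //= => /eqP; exact: val_inj.
- by apply/forallP => -[[|[|[|[|//]]]] i4]; rewrite ffunE.
- apply/forallP => -[[|[|[|[|//]]]] i4]; rewrite !ffunE /=; apply/fintype.subsetP => x;
    by rewrite !inE => /orP[] /eqP ->.
Qed.

(** * Two-paths of the shadow graph *)

Lemma edgeI_le2 e f : e \in H -> f \in H -> e != f -> #|e :&: f| <= 2.
Proof.
move=> eH fH ef; rewrite leqNgt; apply/negP => h; move/negP: ef; apply.
have e1 : e :&: f = e by apply/eqP; rewrite eqEcard subsetIl edge_card.
have f1 : e :&: f = f by apply/eqP; rewrite eqEcard subsetIr edge_card.
by rewrite -{1}e1 f1.
Qed.

Definition adjacent u v := (u != v) && [exists e, (e \in H) && ((u \in e) && (v \in e))].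
Definition shadow_degree v := #|[set w | adjacent v w]|.
Definition degree v := #|[set e in H | v \in e]|.
Definition in_edge u v w := [exists e, (e \in H) && [&& u \in e, v \in e & w \in e]].

(** The 2-paths u - v - w that use two different edges; those inside a single edge are left to
    [in_edge]. *)
Definition linked u v w :=
  [&& v != u, v != w & [exists e, exists f,
    [&& e \in H, f \in H, e != f, u \in e, v \in e, v \in f & w \in f]]].

Lemma linkedP u v w : reflect
  (exists e f, [/\ v != u, v != w, e \in H, f \in H & [/\ e != f, u \in e, v \in e, v \in f & w \in
    f]])
  (linked u v w).
Proof.
apply: (iffP and3P) => [[vu vw /existsP[e /existsP[f /and5P[eH fH ef ue /and3P[ve vf wf]]]]]|].
  by exists e, f; split.
case=> e [f [vu vw eH fH [ef ue ve vf wf]]]; split=> //.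
by apply/existsP; exists e; apply/existsP; exists f; rewrite eH fH ef ue ve vf wf.
Qed.

(** Otherwise e1, f1, f2, e2 are four distinct edges carrying the Berge cycle u v1 w v2. *)
Lemma linked_meet u w v1 v2 e1 f1 e2 f2 : u != w -> v1 != v2 ->
  v1 != u -> v1 != w -> v2 != u -> v2 != w ->
  e1 \in H -> f1 \in H -> e2 \in H -> f2 \in H -> e1 != f1 -> e2 != f2 ->
  u \in e1 -> v1 \in e1 -> v1 \in f1 -> w \in f1 ->
  u \in e2 -> v2 \in e2 -> v2 \in f2 -> w \in f2 ->
  [|| e1 == e2, f1 == f2, e1 == f2 | f1 == e2].
Proof.
move=> uw v12 v1u v1w v2u v2w e1H f1H e2H f2H ef1 ef2 ue1 v1e v1f wf1 ue2 v2e v2f wf2.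
apply/negPn/negP; rewrite !negb_or => /and4P[n1 n2 n3 n4].
apply: (@no_Berge_C4 u v1 w v2 e1 f1 f2 e2) => //=; rewrite !inE !negb_or.
  by rewrite [u == v1]eq_sym [u == v2]eq_sym [w == v2]eq_sym v1u uw v2u v1w v12 v2w.
by rewrite [f2 == e2]eq_sym ef1 n3 n1 n2 n4 ef2.
Qed.

(** Fix one connecting vertex with its edges e1 and f1. By [linked_meet] every other one uses e1 or
    f1, so all of them lie in [e1 :|: f1]. *)
Lemma card_linked_le6 u w : u != w -> #|[set v | linked u v w]| <= 6.
Proof.
move=> uw; have [->|[v1]] := set_0Vmem [set v | linked u v w]; first by rewrite cards0.
rewrite inE => /linkedP[e1 [f1 [v1u v1w e1H f1H [ef1 ue1 v1e v1f wf1]]]].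
apply: leq_trans (_ : #|e1 :|: f1| <= _); last first.
  by apply: leq_trans (leq_card_setU _ _) _; rewrite !edge_card.
apply/subset_leq_card/fintype.subsetP => v2; rewrite inE => /linkedP[e2 [f2 [v2u v2w e2H f2H [ef2
  ue2 v2e v2f wf2]]]].
have [<-|v12] := eqVneq v1 v2; first by rewrite inE v1e.
have := linked_meet uw v12 v1u v1w v2u v2w e1H f1H e2H f2H ef1 ef2 ue1 v1e v1f wf1 ue2 v2e v2f wf2.
by rewrite inE; case/or4P => /eqP ->; rewrite ?v2e ?v2f ?orbT.
Qed.

(* Pairs with two connecting vertices of which only one end sees both in a single edge; since w then
   links them, [card_linked_le6] leaves O(#|H|) such pairs. *)
Definition bad u w := [exists p : T * T,
  [&& p.1 != p.2, in_edge u p.1 p.2 & linked p.1 w p.2]].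

Definition book_at a b u w :=
  [&& a != b, a != u, b != u, a != w, b != w & (in_edge a b u && in_edge a b w)].
Definition book u w := [exists p : T * T, book_at p.1 p.2 u w].

(** Any second connecting vertex uses the same two edges e1 and f1: agreeing in only one of them
    makes (u, w) or (w, u) bad, and a crossed agreement puts u and w into one edge. Hence all
    connecting vertices lie in [e1 :&: f1], which has at most two elements, and two of them form the
    spine of a book with pages u and w. *)
Lemma card_linked_le u w : u != w -> ~~ adjacent u w -> ~~ bad u w -> ~~ bad w u ->
  #|[set v | linked u v w]| <= 1 + book u w.
Proof.
move=> uw nadj nb nb'; rewrite leqNgt; apply/negP => gt.
have /card_gt1P[v1 [v2 []]] : 1 < #|[set v | linked u v w]|.
  by apply: leq_ltn_trans gt; rewrite leq_addr.
rewrite !inE => /linkedP[e1 [f1 [v1u v1w e1H f1H [ef1 ue1 v1e v1f wf1]]]] l2 v12.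
have same v e f : v1 != v -> v != u -> v != w -> e \in H -> f \in H -> e != f -> u \in e -> v \in e
  ->
    v \in f -> w \in f -> e1 = e /\ f1 = f.
  move=> v1v vu vw eH fH ef ue ve vf wf.
  have [ee|ne] := eqVneq e1 e; have [ff|nf] := eqVneq f1 f => //.
  - exfalso; move/negP: nb; apply; apply/existsP; exists (v1, v) => /=; rewrite v1v /=.
    apply/andP; split; first by apply/existsP; exists e1; rewrite e1H ue1 v1e ee ve.
    by apply/linkedP; exists f1, f; split=> //; rewrite 1?eq_sym.
  - exfalso; move/negP: nb'; apply; apply/existsP; exists (v1, v) => /=; rewrite v1v /=.
    apply/andP; split; first by apply/existsP; exists f1; rewrite f1H wf1 v1f ff vf.
    by apply/linkedP; exists e1, e; split=> //; rewrite 1?eq_sym.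
  have := linked_meet uw v1v v1u v1w vu vw e1H f1H eH fH ef1 ef ue1 v1e v1f wf1 ue ve vf wf.
  rewrite (negbTE ne) (negbTE nf) /= => /orP[]/eqP E; exfalso; move/negP: nadj; apply;
    rewrite /adjacent uw.
    by apply/existsP; exists e1; rewrite e1H ue1 E wf.
  by apply/existsP; exists f1; rewrite f1H wf1 E ue.
move/linkedP: l2 => [e2 [f2 [v2u v2w e2H f2H [ef2 ue2 v2e v2f wf2]]]].
have [E F] := same v2 e2 f2 v12 v2u v2w e2H f2H ef2 ue2 v2e v2f wf2.
have bk : book u w.
  apply/existsP; exists (v1, v2); rewrite /book_at /= v12 v1u v2u v1w v2w /=.
  apply/andP; split; apply/existsP; first by exists e1; rewrite e1H v1e ue1 E v2e.
  by exists f1; rewrite f1H v1f wf1 F v2f.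
move: gt; rewrite bk ltnNge => /negP; apply.
apply: leq_trans (edgeI_le2 e1H f1H ef1); apply/subset_leq_card/fintype.subsetP => v.
rewrite !inE => /linkedP[e [f [vu vw eH fH [ef ue ve vf wf]]]].
have [<-|v1v] := eqVneq v1 v; first by rewrite v1e.
by have [-> ->] := same v e f v1v vu vw eH fH ef ue ve vf wf; rewrite ve.
Qed.

Lemma sum_edge_mem h : h \in H -> \sum_x (x \in h) = 3.
Proof. by move=> hH; rewrite sum_mem_card edge_card. Qed.

Lemma sum_in_edge : \sum_u \sum_v \sum_w in_edge u v w <= 27 * #|H|.
Proof.
apply: leq_trans (_ : \sum_u \sum_v \sum_w \sum_(h in H) [&& u \in h, v \in h & w \in h] <= _).
  by do 3!apply: leq_sum => ? _; apply: exists_le_sum.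
under eq_bigr do under eq_bigr do rewrite exchange_big.
under eq_bigr do rewrite exchange_big.
rewrite exchange_big /= mulnC -sum_nat_const; apply: leq_sum => h hH.
have E (u v w : T) : [&& u \in h, v \in h & w \in h] = (u \in h) * ((v \in h) * (w \in h)) :> nat.
  by rewrite !mulnb.
under eq_bigr do under eq_bigr do under eq_bigr do rewrite E.
under eq_bigr do under eq_bigr do rewrite -!big_distrr /= sum_edge_mem //.
under eq_bigr do rewrite -!big_distrr -big_distrl /= sum_edge_mem //.
by rewrite -big_distrl /= sum_edge_mem.
Qed.

Lemma sum_adjacent : \sum_u \sum_w adjacent u w <= 9 * #|H|.
Proof.
apply: leq_trans (_ : \sum_u \sum_w \sum_(h in H) ((u \in h) && (w \in h)) <= _).
  do 2!apply: leq_sum => ? _; rewrite /adjacent; case: (_ != _) => //=; exact: exists_le_sum.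
under eq_bigr do rewrite exchange_big.
rewrite exchange_big /= mulnC -sum_nat_const; apply: leq_sum => h hH.
under eq_bigr do under eq_bigr do rewrite -mulnb.
under eq_bigr do rewrite -!big_distrr /= sum_edge_mem //.
by rewrite -big_distrl /= sum_edge_mem.
Qed.

Lemma sum_bad : \sum_u \sum_w bad u w <= 162 * #|H|.
Proof.
apply: leq_trans (_ : \sum_u \sum_w \sum_v1 \sum_v2 (v1 != v2) * (in_edge u v1 v2 * linked v1 w v2)
  <= _).
  do 2!apply: leq_sum => ? _; apply: leq_trans (exists_le_sumT _) _.
  rewrite pair_big /=; apply: leq_sum => p _; by rewrite !mulnb.
apply: leq_trans (_ : \sum_u \sum_v1 \sum_v2 in_edge u v1 v2 * 6 <= _).
  apply: leq_sum => u _; rewrite exchange_big; apply: leq_sum => v1 _.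
  rewrite exchange_big; apply: leq_sum => v2 _.
  have [->|v12] := eqVneq v1 v2; first by rewrite big1.
  under eq_bigr do rewrite mul1n.
  rewrite -big_distrr /= leq_mul2l; apply/orP; right.
  apply: leq_trans (card_linked_le6 v12); rewrite -sum_mem_card; apply: leq_sum => w _.
  by rewrite inE.
under eq_bigr do under eq_bigr do rewrite -big_distrl /=.
under eq_bigr do rewrite -big_distrl /=.
rewrite -big_distrl /= (_ : 162 = 27 * 6) // mulnAC leq_mul2r; exact: sum_in_edge.
Qed.

(** A book with spine {a, b} and pages u, w yields an ordered pair of distinct edges through a and
    another through b, hence the factor 2. The right side counts ordered pairs of distinct edges at
    a common vertex. *)
Lemma sum_book : 2 * (\sum_u \sum_w (u != w) * book u w) <= \sum_a degree a * (degree a).-1.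
Proof.
pose B (x : (T * T) * (T * T)) := (x.1.1 != x.1.2) && book_at x.2.1 x.2.2 x.1.1 x.1.2.
pose C (y : T * ({set T} * {set T})) :=
  [&& y.2.1 != y.2.2, y.2.1 \in [set e in H | y.1 \in e] & y.2.2 \in [set e in H | y.1 \in e]].
have lower : 2 * (\sum_u \sum_w (u != w) * book u w) <= #|[set x | B x]|.
  rewrite -sum_mem_card; under [X in _ <= X]eq_bigr do rewrite inE.
  rewrite -(pair_bigA _ (fun p q : T * T => (B (p, q) : nat))) /= -(pair_bigA _ (fun u w => \sum_q
    (B ((u, w), q) : nat))) /=.
  rewrite big_distrr /=; apply: leq_sum => u _; rewrite big_distrr /=; apply: leq_sum => w _.
  case: (boolP (u != w)) => uw; last by rewrite muln0.
  rewrite mul1n; case: (boolP (book u w)) => [/existsP[[a b] /= bk]|_]; last by rewrite muln0.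
  have ab : a != b by case/andP: bk.
  rewrite (bigD1 (a, b)) //= (bigD1 (b, a)) /=; last first.
    by rewrite xpair_eqE negb_and eq_sym ab.
  rewrite addnA; apply: leq_trans (leq_addr _ _).
  have bk' : book_at b a u w.
    case/and5P: bk => _ h1 h2 h3 /andP[h4 /andP[h5 h6]].
    rewrite /book_at eq_sym ab h1 h2 h3 h4 /=; apply/andP; split.
      by case/existsP: h5 => e /and4P[? ? ? ?]; apply/existsP; exists e; apply/and4P.
    by case/existsP: h6 => e /and4P[? ? ? ?]; apply/existsP; exists e; apply/and4P.
  by rewrite /B /= uw bk bk'.
have upper : #|[set y | C y]| = \sum_a degree a * (degree a).-1.
  rewrite -sum_mem_card; under eq_bigr do rewrite inE.
  rewrite -(pair_bigA _ (fun a p => (C (a, p) : nat))) /=; apply: eq_bigr => a _.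
  rewrite -(pair_bigA _ (fun e f => (C (a, (e, f)) : nat))) /= -card_off_diagonal.
  by do 2!apply: eq_bigr => ? _; rewrite /C /= andbA.
apply: leq_trans lower _; rewrite -upper.
pose phi (x : (T * T) * (T * T)) := (x.2.1, ([set x.2.1; x.2.2; x.1.1], [set x.2.1; x.2.2; x.1.2])).
have edgeE a b c : a != b -> a != c -> b != c -> in_edge a b c -> [set a; b; c] \in H.
  move=> ab ac bc /existsP[e /and4P[eH ae be ce]]; suff -> : [set a; b; c] = e by [].
  apply/eqP; rewrite eqEcard edge_card //; apply/andP; split.
    by apply/fintype.subsetP => x; rewrite !inE => /orP[/orP[]|] /eqP ->.
  by rewrite -finset.setUA cardsU1 cards2 !inE negb_or ab ac bc.
(* The vertex a is recorded by [phi]; b is the other common element of the two edges, since u and w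
   differ; the pages are what remains. *)
have phi_inj : {in [set x | B x] &, injective phi}.
  move=> [[u w] [a b]] [[u' w'] [a' b']]; rewrite !inE /B /= => /andP[uw /and5P[ab au bu aw
    /andP[bw _]]].
  move=> /andP[uw' /and5P[ab' au' bu' aw' /andP[bw' _]]] [<- E F].
  have bb : b = b'.
    have : b \in [set a; b'; u'] by rewrite -E !inE eqxx orbT.
    have : b \in [set a; b'; w'] by rewrite -F !inE eqxx orbT.
    rewrite !inE ![b == a]eq_sym (negbTE ab) /=.
    case: eqP => //= _ /eqP -> /eqP E'; by rewrite E' eqxx in uw'.
  subst b'.
  have : u \in [set a; b; u'] by rewrite -E !inE eqxx orbT.
  have : w \in [set a; b; w'] by rewrite -F !inE eqxx orbT.
  rewrite !inE ![_ == a]eq_sym ![_ == b]eq_sym (negbTE aw) (negbTE bw) (negbTE au) (negbTE bu) /=.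
  by move=> /eqP -> /eqP ->.
rewrite -(card_in_imset phi_inj); apply/subset_leq_card/fintype.subsetP => y /imsetP[[[u w] [a b]]].
rewrite !inE /B /= => /andP[uw /and5P[ab au bu aw /andP[bw /andP[e1 e2]]]] ->.
rewrite /C /phi /= !inE !eqxx /= !andbT !edgeE // !andbT.
apply/eqP => /setP /(_ u); rewrite !inE eqxx orbT ![u == _]eq_sym (negbTE au) (negbTE bu) /=.
by move/esym/eqP => E; rewrite E eqxx in uw.
Qed.

(** Ordinary pairs carry at most 1 + [book] paths through two edges, the adjacent and bad ones at
    most 6, and paths inside one edge are counted by [in_edge]. The constant is 4050 = 2 * (27 + 6 *
    (9 + 162 + 162)). *)
Lemma sum_shadow_paths :
  2 * (\sum_v shadow_degree v * (shadow_degree v).-1) <=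
  2 * #|T| ^ 2 + \sum_v degree v * (degree v).-1 + 4050 * #|H|.
Proof.
have paths : \sum_v shadow_degree v * (shadow_degree v).-1 =
    \sum_u \sum_w (u != w) * \sum_v (adjacent v u && adjacent v w).
  transitivity (\sum_v \sum_u \sum_w ((u != w) && adjacent v u && adjacent v w)).
    apply: eq_bigr => v _; rewrite -card_off_diagonal; do 2!apply: eq_bigr => ? _.
    by rewrite !inE.
  rewrite exchange_big /=; apply: eq_bigr => u _; rewrite exchange_big /=; apply: eq_bigr => w _.
  by rewrite big_distrr /=; apply: eq_bigr => v _; rewrite -andbA mulnb.
have local u w : (u != w) * \sum_v (adjacent v u && adjacent v w) <=
    1 + (u != w) * book u w + \sum_v in_edge u v w + (adjacent u w + bad u w + bad w u) * 6.
  case: (boolP (u != w)) => uw //; rewrite !mul1n.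
  apply: leq_trans (_ : #|[set v | linked u v w]| + \sum_v in_edge u v w <= _).
    rewrite -sum_mem_card -big_split /=; apply: leq_sum => v _; rewrite inE.
    case: (boolP (adjacent v u)) => //= /andP[vu /existsP[e /and3P[eH ve ue]]].
    case: (boolP (adjacent v w)) => //= /andP[vw /existsP[f /and3P[fH vf wf]]].
    have [E|ef] := eqVneq e f.
      rewrite (_ : in_edge u v w) ?addn1 //; apply/existsP; exists e.
      by rewrite eH ue ve E wf.
    rewrite (_ : linked u v w) //; apply/linkedP; exists e, f; split=> //.
  have := card_linked_le6 uw; have := @card_linked_le u w uw.
  case: (adjacent u w); case: (bad u w); case: (bad w u) => /=; try lia.
have sumT : \sum_(u : T) \sum_(w : T) 1 = #|T| ^ 2.
  by rewrite sum_nat_const sum_nat_const muln1 -mulnn.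
have tot : \sum_v shadow_degree v * (shadow_degree v).-1 <=
    #|T| ^ 2 + \sum_u \sum_w (u != w) * book u w + 27 * #|H| + 6 * (9 * #|H| + 162 * #|H| + 162 *
      #|H|).
  rewrite paths; apply: leq_trans (_ : \sum_u \sum_w (1 + (u != w) * book u w + \sum_v in_edge u v
    w +
      (adjacent u w + bad u w + bad w u) * 6) <= _).
    by do 2!apply: leq_sum => ? _.
  rewrite !sum2D sum2M !sum2D sumT.
  have h1 : \sum_u \sum_w \sum_v in_edge u v w <= 27 * #|H|.
    by under eq_bigr do rewrite exchange_big /=; exact: sum_in_edge.
  have h2 : \sum_u \sum_w bad w u <= 162 * #|H| by rewrite exchange_big /=; exact: sum_bad.
  have := sum_adjacent; have := sum_bad; lia.
have := sum_book; lia.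
Qed.

(** * Degrees and the discharging argument *)

Lemma sum_degree : \sum_v degree v = 3 * #|H|.
Proof.
transitivity (\sum_v \sum_(h in H) (v \in h)).
  apply: eq_bigr => v _; rewrite /degree -sum_mem_card [RHS]big_mkcond; apply: eq_bigr => h _.
  by rewrite inE; case: (h \in H).
rewrite exchange_big /= mulnC -sum_nat_const; apply: eq_bigr => h hH.
exact: sum_edge_mem.
Qed.

Lemma shadow_degree_le v : shadow_degree v <= 2 * degree v.
Proof.
rewrite /shadow_degree -sum_mem_card.
apply: leq_trans (_ : \sum_w \sum_(h in [set e in H | v \in e]) (w \in h :\ v) <= _).
  apply: leq_sum => w _; rewrite inE; case: (boolP (adjacent v w)) => //= /andP[vw /existsP[e
    /and3P[eH ve we]]].
  rewrite (bigD1 e) /=; last by rewrite inE eH.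
  by rewrite !inE we eq_sym vw.
rewrite exchange_big /= /degree mulnC -sum_nat_const; apply: leq_sum => h;
  rewrite inE => /andP[hH vh].
by rewrite sum_mem_card; have := cardsD1 v h; rewrite vh edge_card // add1n => -[<-].
Qed.

(** Distinctness of the three vertices is not stated: 3-uniformity forces it, see [triple_neq]. *)
Definition triple a b c := [set a; b; c] \in H.

Lemma card_set3 (a b c : T) : a != b -> a != c -> b != c -> #|[set a; b; c]| = 3.
Proof. by move=> ab ac bc; rewrite -finset.setUA cardsU1 cards2 !inE negb_or ab ac bc. Qed.

Lemma tripleC a b c : triple a b c = triple b a c.
Proof. by rewrite /triple [[set a; b]]finset.setUC. Qed.

Lemma tripleA a b c : triple a b c = triple a c b.
Proof. by rewrite /triple finset.setUAC. Qed.

Lemma triple_neq a b c : triple a b c -> [/\ a != b, a != c & b != c].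
Proof.
move=> t; have c3 := edge_card t; split; apply/eqP => E; move: c3; rewrite E.
- by rewrite finset.setUid cards2; case: (_ == _).
- by rewrite finset.setUAC finset.setUid cards2; case: (_ == _).
- by rewrite -finset.setUA finset.setUid cards2; case: (_ == _).
Qed.

Lemma edge_third h a b : h \in H -> a \in h -> b \in h -> a != b ->
  exists2 x, h = [set a; b; x] & triple a b x.
Proof.
move=> hH ah bh ab.
have c1 : #|h :\ a :\ b| == 1.
  have := cardsD1 a h; rewrite ah edge_card // add1n => -[E].
  have := cardsD1 b (h :\ a); rewrite !inE bh eq_sym ab -E add1n => -[<-] //.
have /cards1P[x xE] := c1.
have : x \in h :\ a :\ b by rewrite xE inE.
rewrite !inE => /and3P[xb xa xh].
have hE : h = [set a; b; x].
  have c3 : #|[set a; b; x]| = 3 by apply: card_set3; rewrite // eq_sym.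
  apply/esym/eqP; rewrite eqEcard edge_card // c3 leqnn andbT.
  by apply/fintype.subsetP => y; rewrite !inE => /orP[/orP[]|] /eqP ->.
by exists x; rewrite // /triple -hE.
Qed.

Definition heavy a b := 1 < #|[set h in H | (a \in h) && (b \in h)]|.

Lemma heavyC a b : heavy a b = heavy b a.
Proof. by congr (1 < #|pred_of_set _|); apply/setP => h; rewrite !inE [_ && (b \in h)]andbC. Qed.

Lemma heavy_other a b x : heavy a b -> triple a b x -> exists2 y, y != x & triple a b y.
Proof.
move=> /card_gt1P[h1 [h2 []]]; rewrite !inE => /and3P[h1H a1 b1] /and3P[h2H a2 b2] h12 t.
have [ab _ _] := triple_neq t.
have [y1 E1 t1] := edge_third h1H a1 b1 ab; have [y2 E2 t2] := edge_third h2H a2 b2 ab.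
have [y1x|] := eqVneq y1 x; last by exists y1.
exists y2 => //; apply/eqP => y2x; by rewrite E1 E2 y1x y2x eqxx in h12.
Qed.

Ltac simp_neq := repeat match goal with
  | N : is_true (?a != ?b) |- context [?a == ?b] => rewrite (negbTE N)
  | N : is_true (?a != ?b) |- context [?b == ?a] => rewrite (eq_sym b a) (negbTE N)
  end.

Ltac set_neq p := apply/eqP => /setP /(_ p); rewrite !inE ?eqxx ?orbT /=; simp_neq; done.

(** A further edge {a, x, z} with z != b and a further edge {b, y, w} with w != a close the Berge
    cycle a x b y together with {a, b, x} and {a, b, y}. *)
Lemma two_central_opposite a b x y : triple a b x -> triple a b y -> x != y ->
  heavy a x -> heavy b y -> False.
Proof.
move=> tx ty xy hax hby.
have tax : triple a x b by rewrite tripleA.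
have tby : triple b y a by rewrite -tripleA tripleC.
have [z zb tz] := heavy_other hax tax; have [w wa tw] := heavy_other hby tby.
have [ab ax bx] := triple_neq tx; have [_ ay by'] := triple_neq ty.
have [_ az xz] := triple_neq tz; have [_ bw yw] := triple_neq tw.
apply: (@no_Berge_C4 a x b y [set a; x; z] [set a; b; x] [set b; y; w] [set a; b; y]) => //;
  rewrite ?inE ?eqxx ?orbT //=.
  by rewrite !inE !negb_or; simp_neq.
rewrite !inE !negb_or andbT; apply/and3P; split; [apply/and3P; split | apply/andP; split | ].
- by set_neq b.
- by set_neq a.
- by set_neq b.
- by set_neq a.
- by set_neq x.
- by set_neq a.
Qed.

(** If z != y, then {a, b, x}, {a, b, y}, {a, y, w}, {a, x, z} are distinct and carry the Berge
    cycle x b y a. *)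
Lemma two_central_adjacent a b x y z w : triple a b x -> triple a b y -> x != y ->
  triple a x z -> z != b -> triple a y w -> w != b -> z = y.
Proof.
move=> tx ty xy tz zb tw wb; apply/eqP/negPn/negP => zy.
have [ab ax bx] := triple_neq tx; have [_ ay by'] := triple_neq ty.
have [_ az xz] := triple_neq tz; have [_ aw yw] := triple_neq tw.
apply: (@no_Berge_C4 x b y a [set a; b; x] [set a; b; y] [set a; y; w] [set a; x; z]) => //;
  rewrite ?inE ?eqxx ?orbT //=.
  by rewrite !inE !negb_or; simp_neq.
rewrite !inE !negb_or andbT; apply/and3P; split; [apply/and3P; split | apply/andP; split | ].
- by set_neq x.
- by set_neq b.
- by set_neq b.
- by set_neq b.
- by set_neq b.
- by set_neq y.
Qed.

(* Every heavy pair is counted twice in the sum, so [h] is central when it has at least two. *)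
Definition central h := 2 < \sum_(v in h) \sum_(w in h :\ v) heavy v w.

Lemma sum_set3 (G : T -> nat) a b c : a != b -> a != c -> b != c ->
  \sum_(v in [set a; b; c]) G v = G a + G b + G c.
Proof.
move=> ab ac bc; rewrite -finset.setUA big_setU1 /=; last by rewrite !inE negb_or ab ac.
by rewrite big_setU1 /= ?inE // big_set1 addnA.
Qed.

Lemma sum_set3D1 (G : T -> nat) a b c : a != b -> a != c -> b != c ->
  [/\ \sum_(v in [set a; b; c] :\ a) G v = G b + G c,
      \sum_(v in [set a; b; c] :\ b) G v = G a + G c &
      \sum_(v in [set a; b; c] :\ c) G v = G a + G b].
Proof.
move=> ab ac bc; have E := sum_set3 G ab ac bc.
have D v : v \in [set a; b; c] -> G a + G b + G c = G v + \sum_(w in [set a; b; c] :\ v) G w.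
  by move=> vh; rewrite -E (big_setD1 v).
have := D a; have := D b; have := D c; rewrite !inE !eqxx !orbT => /(_ isT) h1 /(_ isT) h2 /(_ isT)
  h3.
split; lia.
Qed.

Lemma sum_triple_pairs (F : T -> T -> nat) a b c : triple a b c ->
  \sum_(v in [set a; b; c]) \sum_(w in [set a; b; c] :\ v) F v w =
  (F a b + F a c) + (F b a + F b c) + (F c a + F c b).
Proof.
move=> /triple_neq[ab ac bc]; rewrite sum_set3 //.
have [-> _ _] := sum_set3D1 (F a) ab ac bc; have [_ -> _] := sum_set3D1 (F b) ab ac bc.
by have [_ _ ->] := sum_set3D1 (F c) ab ac bc.
Qed.

Lemma centralE a b c : triple a b c ->
  central [set a; b; c] = (1 < heavy a b + heavy a c + heavy b c).
Proof.
move=> t; rewrite /central sum_triple_pairs // [heavy b a]heavyC [heavy c a]heavyC [heavy c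
  b]heavyC.
by case: (heavy a b); case: (heavy a c); case: (heavy b c).
Qed.

(** Each of the two central edges has a heavy pair besides ab. By [two_central_opposite] these pairs
    meet ab at the same end, say a; then [two_central_adjacent] forces the further edges on ax and
    ay to be {a, x, y}. *)
Lemma two_central a b x y : triple a b x -> triple a b y -> x != y ->
  central [set a; b; x] -> central [set a; b; y] ->
  [/\ heavy a x, ~~ heavy b x, heavy a y, ~~ heavy b y & triple a x y] \/
  [/\ heavy b x, ~~ heavy a x, heavy b y, ~~ heavy a y & triple b x y].
Proof.
move=> tx ty xy; rewrite !centralE // => cx cy.
have n1 := two_central_opposite tx ty xy.
have tx' : triple b a x by rewrite tripleC.
have ty' : triple b a y by rewrite tripleC.
have n2 := two_central_opposite tx' ty' xy.
have [_ ax bx] := triple_neq tx; have [_ ay by'] := triple_neq ty.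
have key a' b' : triple a' b' x -> triple a' b' y -> heavy a' x -> heavy a' y -> triple a' x y.
  move=> t1 t2 h1 h2.
  have [z zb tz] : exists2 z, z != b' & triple a' x z by apply: heavy_other h1 _; rewrite tripleA.
  have [w wb tw] : exists2 w, w != b' & triple a' y w by apply: heavy_other h2 _; rewrite tripleA.
  by rewrite -(two_central_adjacent t1 t2 xy tz zb tw wb).
have [hax|nax] := boolP (heavy a x).
  have nby : ~~ heavy b y by apply/negP => hby; apply: n1.
  have hay : heavy a y by move: cy; rewrite (negbTE nby); case: (heavy a y) => //;
    case: (heavy a b).
  have nbx : ~~ heavy b x by apply/negP => hbx; apply: n2.
  by left; split=> //; apply: (key a b).
have hbx : heavy b x by move: cx; rewrite (negbTE nax); case: (heavy b x) => //; case: (heavy a b).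
have nay : ~~ heavy a y by apply/negP => hay; apply: n2.
have hby : heavy b y by move: cy; rewrite (negbTE nay); case: (heavy b y) => //; case: (heavy a b).
by right; split=> //; apply: (key b a).
Qed.

Definition central_count a b := #|[set h in H | [&& a \in h, b \in h & central h]]|.

Lemma central_countC a b : central_count a b = central_count b a.
Proof. by congr (#|pred_of_set _|); apply/setP => h; rewrite !inE; case: (a \in h);
  case: (b \in h). Qed.

(** Let {a, b, x}, {a, b, y}, {a, b, z} be central. Exactly one of ax, bx is heavy, so [two_central]
    for the pairs x, y and x, z selects the same end, say a, and gives the edges {a, x, y} and {a,
    x, z}; [two_central_adjacent] then yields z = y. *)
Lemma central_count_le2 a b : a != b -> central_count a b <= 2.
Proof.
move=> ab; rewrite leqNgt; apply/negP => /card_gt2P[h1 [h2 [h3 [[]]]]].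
rewrite !inE => /and4P[h1H a1 b1 c1] /and4P[h2H a2 b2 c2] /and4P[h3H a3 b3 c3] [n12 n23 n31].
have [x E1 tx] := edge_third h1H a1 b1 ab; have [y E2 ty] := edge_third h2H a2 b2 ab.
have [z E3 tz] := edge_third h3H a3 b3 ab; subst h1 h2 h3.
have xy : x != y by apply: contraNneq n12 => ->.
have xz : x != z by apply: contraNneq n31 => ->.
have yz : y != z by apply: contraNneq n23 => ->.
have [_ ax bx] := triple_neq tx; have [_ ay by'] := triple_neq ty; have [_ az bz] := triple_neq tz.
have [[h1 n1 h2 n2 txy]|[h1 n1 h2 n2 txy]] := two_central tx ty xy c1 c2;
  have [[h3 n3 h4 n4 txz]|[h3 n3 h4 n4 txz]] := two_central tx tz xz c1 c3;
  rewrite ?h1 ?h3 // in n1 n3.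
  have tyx : triple a y x by rewrite tripleA.
  have := two_central_adjacent tx ty xy txz; rewrite eq_sym bz => /(_ x isT tyx);
    rewrite eq_sym bx => /(_ isT) E.
  by rewrite E eqxx in yz.
have tx' : triple b a x by rewrite tripleC.
have ty' : triple b a y by rewrite tripleC.
have tyx : triple b y x by rewrite tripleA.
have := two_central_adjacent tx' ty' xy txz; rewrite eq_sym az => /(_ x isT tyx);
  rewrite eq_sym ax => /(_ isT) E.
by rewrite E eqxx in yz.
Qed.

(* Discharging: a pair spends 2, a light one on its only edge and a heavy one on the central edges
   containing it, of which there are two only inside three edges on four vertices. *)
Definition share a b h : nat :=
  if heavy a b then (if central h then (if central_count a b <= 1 then 2 else 1) else 0) else 2.

Lemma shareC a b h : share a b h = share b a h.
Proof. by rewrite /share heavyC central_countC. Qed.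

Lemma sum_share a b :
  \sum_(h in H) [&& a != b, a \in h & b \in h] * share a b h <= 2 * adjacent a b.
Proof.
have [->|ab] := eqVneq a b; first by rewrite big1.
have [adj|nadj] := boolP (adjacent a b); last first.
  rewrite big1 // => h hH; case: (boolP ((a \in h) && (b \in h))) => //= abh; exfalso;
    move/negP: nadj; apply.
  by rewrite /adjacent ab; apply/existsP; exists h; rewrite hH.
rewrite /= /share; case: (boolP (heavy a b)) => hv; last first.
  rewrite -leqNgt in hv; rewrite -big_distrl /= mulnC leq_mul2l /=.
  apply: leq_trans hv; rewrite -sum_mem_card [X in X <= _]big_mkcond /=.
  by apply: leq_sum => h _; rewrite !inE; case: (h \in H).
have E k : \sum_(h in H) ((a \in h) && (b \in h)) * (if central h then k else 0) = central_count a
  b * k.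
  rewrite /central_count -sum_mem_card big_distrl /= big_mkcond /=; apply: eq_bigr => h _.
  by rewrite !inE; case: (h \in H); case: (a \in h); case: (b \in h); case: (central h);
    rewrite ?muln0 ?mul0n.
rewrite E; have := central_count_le2 ab; case: (leqP (central_count a b) 1); lia.
Qed.

(** A non-central edge has at most one heavy pair, so two light pairs pay 2 each. In a central edge
    every pair pays at least 1, and pays only 1 when it is heavy and lies in two central edges;
    [two_central] then makes one of the other pairs light, and that one pays 2. *)
Lemma share_triple a b c : triple a b c ->
  [/\ 2 <= share a b [set a; b; c] + share a c [set a; b; c],
      2 <= share a b [set a; b; c] + share b c [set a; b; c],
      2 <= share a c [set a; b; c] + share b c [set a; b; c] &
      4 <= share a b [set a; b; c] + share a c [set a; b; c] + share b c [set a; b; c]].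
Proof.
move=> t; have [ab ac bc] := triple_neq t; have cE := centralE t; move: cE.
have two u v w : triple u v w -> central [set u; v; w] -> heavy u v -> 1 < central_count u v ->
    ~~ heavy u w \/ ~~ heavy v w.
  move=> tw cw hv /card_gt1P[h1 [h2 []]]; rewrite !inE => /and4P[h1H a1 b1 c1] /and4P[h2H a2 b2 c2]
    n12.
  have [uv _ _] := triple_neq tw.
  have [x E1 tx] := edge_third h1H a1 b1 uv; have [y E2 ty] := edge_third h2H a2 b2 uv; subst h1 h2.
  have [xw|xw] := eqVneq x w.
    have wy : w != y by apply: contraNneq n12 => <-; rewrite xw.
    by have [[]|[]] := two_central tw ty wy cw c2; [right | left].
  rewrite eq_sym in xw.
  by have [[]|[]] := two_central tw tx xw cw c1; [right | left].
rewrite /share; case: (boolP (central _)) => cen; last first.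
  by case: (heavy a b); case: (heavy a c); case: (heavy b c).
have := two a b c t cen; case: (heavy a b); case: (heavy a c); case: (heavy b c) => //=;
  case: (leqP (central_count a b) 1); case: (leqP (central_count a c) 1);
    case: (leqP (central_count b c) 1) => //= *;
  by split; lia.
Qed.

Lemma shadow_degree_sum v : \sum_w adjacent v w = shadow_degree v.
Proof. by rewrite /shadow_degree -sum_mem_card; apply: eq_bigr => w _; rewrite inE. Qed.

Lemma share_at v h : h \in H -> v \in h -> 2 <= \sum_(w in h :\ v) share v w h.
Proof.
move=> hH vh; have /card_gt0P[b] : 0 < #|h :\ v|.
  by have := cardsD1 v h; rewrite vh edge_card // add1n => -[<-].
rewrite !inE => /andP[bv bh]; rewrite eq_sym in bv.
have [c E t] := edge_third hH vh bh bv; rewrite E.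
have [ab ac bc] := triple_neq t.
by have [-> _ _] := sum_set3D1 (fun w => share v w [set v; b; c]) ab ac bc;
  have [] := share_triple t.
Qed.

(** The double sum runs over ordered pairs, which doubles the 4 of [share_triple]. *)
Lemma share_total h : h \in H -> 8 <= \sum_(v in h) \sum_(w in h :\ v) share v w h.
Proof.
move=> hH; have /card_gt1P[a [b [ah bh ab]]] : 1 < #|h| by rewrite edge_card.
have [c E t] := edge_third hH ah bh ab; rewrite E sum_triple_pairs //.
have [_ _ _] := share_triple t.
rewrite [share b a _]shareC [share c a _]shareC [share c b _]shareC; lia.
Qed.

(** The supply side of the discharging: every shadow edge at v spends at most 2. Set against what
    the edges receive, [share_at] yields [degree_le_shadow] and [share_total] yields
    [sum_shadow_degree]. *)
Lemma share_exchange v :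
  \sum_(h in H) (v \in h) * \sum_(w in h :\ v) share v w h <= 2 * shadow_degree v.
Proof.
rewrite -shadow_degree_sum big_distrr /=.
apply: leq_trans (_ : \sum_w \sum_(h in H) [&& v != w, v \in h & w \in h] * share v w h <= _);
  last first.
  by apply: leq_sum => w _; apply: sum_share.
rewrite exchange_big /=; apply: leq_sum => h hH.
case: (boolP (v \in h)) => vh //; rewrite mul1n big_mkcond /=; apply: leq_sum => w _.
by rewrite !inE eq_sym; case: (_ != _); case: (w \in h); rewrite ?mul1n.
Qed.

Lemma degree_le_shadow v : degree v <= shadow_degree v.
Proof.
have := share_exchange v; suff : 2 * degree v <= \sum_(h in H) (v \in h) * \sum_(w in h :\ v) share
  v w h by lia.
rewrite /degree -sum_mem_card big_distrr /= [X in _ <= X]big_mkcond /=; apply: leq_sum => h _.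
rewrite inE; case: (boolP (h \in H)) => hH //=; case: (boolP (v \in h)) => vh //.
by rewrite muln1 mul1n share_at.
Qed.

Lemma sum_shadow_degree : 4 * #|H| <= \sum_v shadow_degree v.
Proof.
suff : 8 * #|H| <= 2 * \sum_v shadow_degree v by lia.
rewrite big_distrr /=; apply: leq_trans (_ : \sum_v \sum_(h in H) (v \in h) * \sum_(w in h :\ v)
  share v w h <= _); last first.
  by apply: leq_sum => v _; apply: share_exchange.
rewrite exchange_big /= mulnC -sum_nat_const; apply: leq_sum => h hH.
apply: leq_trans (share_total hH) _; rewrite big_mkcond /=; apply: leq_sum => v _.
by case: (v \in h); rewrite ?mul1n.
Qed.

(** * Cauchy-Schwarz and the final inequality *)

Lemma square_sum_le (I : finType) (F : I -> nat) : (\sum_i F i) ^ 2 <= #|I| * \sum_i F i ^ 2.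
Proof.
suff : 2 * (\sum_i F i) ^ 2 <= 2 * (#|I| * \sum_i F i ^ 2) by lia.
rewrite -mulnn big_distrlr /= big_distrr /=.
apply: leq_trans (_ : \sum_i \sum_j (F i ^ 2 + F j ^ 2) <= _).
  by apply: leq_sum => i _; rewrite big_distrr /=; apply: leq_sum => j _; apply: nat_Cauchy.
have E : \sum_i \sum_(j : I) F i ^ 2 = #|I| * \sum_i F i ^ 2.
  by rewrite big_distrr /=; apply: eq_bigr => i _; rewrite sum_nat_const.
by rewrite sum2D sum_nat_const E addnn -mul2n.
Qed.

Lemma Berge_C4_free_bound : 81 * #|H| ^ 2 <= 8 * #|T| ^ 3 + 4 * (4060 * (#|T| * #|H|)).
Proof.
(* The truncated subtraction is exact, because d <= D pointwise. *)
pose x v := 3 * shadow_degree v - degree v.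
have le v := degree_le_shadow v; have le2 v := shadow_degree_le v.
have s1 : \sum_v x v + \sum_v degree v = 3 * \sum_v shadow_degree v.
  by rewrite -big_split big_distrr /=; apply: eq_bigr => v _; rewrite /x subnK //; have := le v;
    lia.
have s2 : \sum_v x v ^ 2 + 4 * \sum_v degree v ^ 2 <= 8 * \sum_v shadow_degree v ^ 2.
  (* (3 D - d)^2 + 4 d^2 <= 8 D^2 amounts to (D - d) (D - 5 d) <= 0. *)
  rewrite !big_distrr -big_split /=; apply: leq_sum => v _.
  have := le v; have := le2 v; rewrite /x; move: (shadow_degree v) (degree v) => D d l2 l1.
  have [k E] : exists k, D = d + k by exists (D - d); rewrite subnKC.
  have -> : 3 * D - d = 2 * d + 3 * k by lia.
  have kd : k <= d by lia.
  rewrite E; nia.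
have pr n : n * n.-1 + n = n ^ 2 by case: n => // n; rewrite -mulnSr mulnn.
have sD : \sum_v shadow_degree v * (shadow_degree v).-1 + \sum_v shadow_degree v = \sum_v
  shadow_degree v ^ 2.
  by rewrite -big_split; apply: eq_bigr => v _; apply: pr.
have sd : \sum_v degree v * (degree v).-1 + \sum_v degree v = \sum_v degree v ^ 2.
  by rewrite -big_split; apply: eq_bigr => v _; apply: pr.
have sD6 : \sum_v shadow_degree v <= 6 * #|H|.
  rewrite (_ : 6 = 2 * 3) // -mulnA -sum_degree big_distrr /=; exact: leq_sum.
have := sum_shadow_paths; have := sum_shadow_degree; have := sum_degree => sdeg sD4 paths.
(* 9 = 3 * 4 - 3, from the sums of D and of d. *)
have x9 : 9 * #|H| <= \sum_v x v by lia.
(* Passing from D (D - 1) and d (d - 1) to squares costs 8 D - 4 d, in total at most 36 * [#|H|];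
   this is covered by raising 4050 to 4060 under the factor 4. *)
have xx : \sum_v x v ^ 2 <= 8 * #|T| ^ 2 + 4 * (4060 * #|H|) by lia.
have cs := square_sum_le x.
have : (9 * #|H|) ^ 2 <= #|T| * (8 * #|T| ^ 2 + 4 * (4060 * #|H|)).
  apply: leq_trans (leq_trans cs _); first by rewrite leq_exp2r.
  by rewrite leq_mul2l xx orbT.
rewrite !expnS !expn0; nia.
Qed.

End BergeC4Free.

(** * The doubled affine plane *)

Section DoubledAffinePlane.
Variables (F : finFieldType) (n : nat).
Hypothesis Fn : 3 * #|F| ^ 2 <= n.

Local Notation vertex := ((bool * (F * F)) + (F * F))%type.
Implicit Types (u : vertex) (t : F * (F * F)) (l p : F * F).

(* [inl (i, p)] is the i-th copy of the point [p], [inr (m, b)] the line y = m x + b, and the flag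
   [(x, (m, b))] is this line with its point of abscissa [x]. *)
Definition flag_point t : F * F := (t.1, t.2.1 * t.1 + t.2.2)%R.
Definition flag_line t : F * F := t.2.

Definition on_flag u t :=
  match u with inl (_, p) => p == flag_point t | inr l => l == flag_line t end.

Lemma flag_eq t t' : flag_point t = flag_point t' -> flag_line t = flag_line t' -> t = t'.
Proof. by case: t t' => [x l] [x' l'] [-> _] /= ->. Qed.

Lemma on_flag_lines t u u' l l' : u = inr l -> u' = inr l' -> u != u' ->
  on_flag u t -> on_flag u' t -> False.
Proof. by move=> -> -> + /eqP E /eqP E' => /eqP[]; rewrite E E'. Qed.

(** All three vertices are copies of one point, and a point has only two copies. *)
Lemma on_flag_points t t' u u' u'' q q' q'' : u = inl q -> u' = inl q' -> u'' = inl q'' ->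
  u != u' -> u' != u'' -> u != u'' ->
  on_flag u t -> on_flag u' t -> on_flag u' t' -> on_flag u'' t' -> False.
Proof.
move=> -> -> ->; case: q q' q'' => [i p] [i' p'] [i'' p''] /= n1 n2 n3 /eqP E1 /eqP E2 /eqP E3 /eqP
  E4.
have pp : p = p' by rewrite E1 E2.
have pp' : p' = p'' by rewrite E3 E4.
move: n1 n2 n3; rewrite -pp' -pp.
have : [|| i == i', i' == i'' | i == i''] by case: i; case: i'; case: i''.
by case/or3P => /eqP ->; rewrite eqxx.
Qed.

Lemma flag_incident t p l : p = flag_point t -> l = flag_line t -> (p.2 = l.1 * p.1 + l.2)%R.
Proof. by move=> -> ->. Qed.

Lemma two_lines_meet_once p p' l l' : (p.2 = l.1 * p.1 + l.2)%R -> (p.2 = l'.1 * p.1 + l'.2)%R ->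
  (p'.2 = l.1 * p'.1 + l.2)%R -> (p'.2 = l'.1 * p'.1 + l'.2)%R -> p = p' \/ l = l'.
Proof.
case: p p' l l' => [x y] [x' y'] [m b] [m' b'] /= E1 E2 E3 E4.
have /eqP : ((m - m') * (x - x') = 0)%R.
  have -> : ((m - m') * (x - x') = (m * x + b) - (m' * x + b') - ((m * x' + b) - (m' * x' + b')))%R
    by ring.
  by rewrite -E1 -E2 -E3 -E4 !subrr.
rewrite mulf_eq0 !subr_eq0 => /orP[/eqP mm|/eqP xx].
  by right; subst m'; move: E1; rewrite E2 => /addrI ->.
by left; rewrite E1 E3 xx.
Qed.

(** Both points lie on both lines. Equal lines contradict [u0 != u2]; equal points give t0 and t3
    the same point and the same line, so t0 = t3. *)
Lemma on_flag_alternating t0 t1 t2 t3 u0 u1 u2 u3 l q l' q' :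
  u0 = inr l -> u1 = inl q -> u2 = inr l' -> u3 = inl q' -> u0 != u2 -> t0 != t3 ->
  on_flag u0 t0 -> on_flag u1 t0 -> on_flag u1 t1 -> on_flag u2 t1 ->
  on_flag u2 t2 -> on_flag u3 t2 -> on_flag u3 t3 -> on_flag u0 t3 -> False.
Proof.
move=> -> -> -> ->; case: q q' => [i p] [i' p'] /= ll tt /eqP a1 /eqP a2 /eqP a3 /eqP a4 /eqP a5
  /eqP a6 /eqP a7 /eqP a8.
have [pp|lle] := two_lines_meet_once (flag_incident a2 a1) (flag_incident a3 a4)
  (flag_incident a7 a8) (flag_incident a6 a5).
  by move/eqP: tt; apply; apply: flag_eq; rewrite -?a1 -?a2 ?pp.
by rewrite lle eqxx in ll.
Qed.

(** Two consecutive lines would share a flag, and three consecutive points would be copies of one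
    point. What remains is the alternation of lines and points, in its two rotations. *)
Lemma no_flag_cycle t0 t1 t2 t3 u0 u1 u2 u3 :
  uniq [:: u0; u1; u2; u3] -> uniq [:: t0; t1; t2; t3] ->
  on_flag u0 t0 -> on_flag u1 t0 -> on_flag u1 t1 -> on_flag u2 t1 ->
  on_flag u2 t2 -> on_flag u3 t2 -> on_flag u3 t3 -> on_flag u0 t3 -> False.
Proof.
rewrite /= !inE !negb_or !andbT => /and3P[/and3P[u01 u02 u03] /andP[u12 u13] u23].
move=> /and3P[/and3P[t01 t02 t03] /andP[t12 t13] t23] a1 a2 a3 a4 a5 a6 a7 a8.
have u10 : u1 != u0 by rewrite eq_sym.
have u20 : u2 != u0 by rewrite eq_sym.
have u30 : u3 != u0 by rewrite eq_sym.
have u31 : u3 != u1 by rewrite eq_sym.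
have t10 : t1 != t0 by rewrite eq_sym.
case E0: u0 => [q0|l0]; case E1: u1 => [q1|l1]; case E2: u2 => [q2|l2]; case E3: u3 => [q3|l3];
first [ exact: (on_flag_lines E0 E1 u01 a1 a2)
      | exact: (on_flag_lines E1 E2 u12 a3 a4)
      | exact: (on_flag_lines E2 E3 u23 a5 a6)
      | exact: (on_flag_lines E3 E0 u30 a7 a8)
      | exact: (on_flag_points E0 E1 E2 u01 u12 u02 a1 a2 a3 a4)
      | exact: (on_flag_points E1 E2 E3 u12 u23 u13 a3 a4 a5 a6)
      | exact: (on_flag_points E2 E3 E0 u23 u30 u20 a5 a6 a7 a8)
      | exact: (on_flag_points E3 E0 E1 u30 u01 u31 a7 a8 a1 a2)
      | exact: (on_flag_alternating E0 E1 E2 E3 u02 t03 a1 a2 a3 a4 a5 a6 a7 a8)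
      | exact: (on_flag_alternating E1 E2 E3 E0 u13 t10 a3 a4 a5 a6 a7 a8 a1 a2) ].
Qed.

Lemma vertex_card : #|{: vertex}| <= n.
Proof. by apply: leq_trans Fn; rewrite card_sum !card_prod card_bool -mulnn;
  move: (#|F| * #|F|) => k; lia. Qed.

Definition vertex_ord u : 'I_n := widen_ord vertex_card (enum_rank u).

Lemma vertex_ord_inj : injective vertex_ord.
Proof. by move=> u u' /(congr1 val) /= /val_inj /enum_rank_inj. Qed.

Definition flag_edge t : {set 'I_n} :=
  [set vertex_ord (inl (false, flag_point t)); vertex_ord (inl (true, flag_point t));
       vertex_ord (inr (flag_line t))].

Lemma in_flag_edge u t : (vertex_ord u \in flag_edge t) = on_flag u t.
Proof.
rewrite !inE !(inj_eq vertex_ord_inj); case: u => [[i p]|l] /=; last by [].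
rewrite orbF !/(_ == _) /= ; by case: i; rewrite /= ?orbF.
Qed.

Lemma flag_edge_vertex (i : 'I_n) t : i \in flag_edge t -> exists u, i = vertex_ord u.
Proof. by rewrite !inE => /orP[/orP[]|] /eqP ->; eexists. Qed.

Lemma flag_edge_inj : injective flag_edge.
Proof.
move=> t t' E; apply: flag_eq.
  have : vertex_ord (inl (false, flag_point t)) \in flag_edge t' by rewrite -E in_flag_edge /=.
  by rewrite in_flag_edge /= => /eqP.
have : vertex_ord (inr (flag_line t)) \in flag_edge t' by rewrite -E in_flag_edge /=.
by rewrite in_flag_edge /= => /eqP.
Qed.

(** One edge per flag: a line and an abscissa determine a flag, so there are q ^ 3 of them, and a
    Berge cycle of edges pulls back to a cycle of flags. *)
Lemma ex_Berge_C4_ge : #|F| ^ 3 <= ex_Berge 3 n 4.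
Proof.
pose H := [set flag_edge t | t : F * (F * F)].
have -> : #|F| ^ 3 = #|H|.
  by rewrite card_imset ?cardsT; [rewrite !card_prod !expnS expn0 muln1 | exact: flag_edge_inj].
rewrite /ex_Berge; apply: (@leq_bigmax_cond _ _ (fun H : {set {set 'I_n}} => #|H|) H).
apply/andP; split.
  apply/forallP => e; apply/implyP => /imsetP[t _ ->].
  by rewrite /flag_edge -finset.setUA cardsU1 cards2 !inE !(inj_eq vertex_ord_inj) /=.
apply/negP => /existsP[v /existsP[e /and4P[/injectiveP vi /injectiveP ei /forallP eH /forallP
  sub]]].
have ve (i : 'I_4) : v i \in e i by apply: (fintype.subsetP (sub i)); rewrite !inE eqxx.
have vs (i : 'I_4) : v (ordS i) \in e i by apply: (fintype.subsetP (sub i)); rewrite !inE eqxx orbT.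
have /fin_all_exists[t tE] (i : 'I_4) : exists t, e i = flag_edge t.
  by have /imsetP[t _ ->] := eH i; exists t.
have /fin_all_exists[u uE] (i : 'I_4) : exists u, v i = vertex_ord u.
  by apply: (@flag_edge_vertex _ (t i)); rewrite -tE.
have inc1 i : on_flag (u i) (t i) by rewrite -in_flag_edge -uE -tE.
have inc2 i : on_flag (u (ordS i)) (t i) by rewrite -in_flag_edge -uE -tE.
have ui : injective u by move=> i j E; apply: vi; rewrite !uE E.
have ti : injective t by move=> i j E; apply: ei; rewrite !tE E.
pose o k (k4 : k < 4) : 'I_4 := Ordinal k4.
have S3 : ordS (@o 3 isT) = @o 0 isT by apply: val_inj.
have S0 : ordS (@o 0 isT) = @o 1 isT by apply: val_inj.
have S1 : ordS (@o 1 isT) = @o 2 isT by apply: val_inj.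
have S2 : ordS (@o 2 isT) = @o 3 isT by apply: val_inj.
have := inc2 (@o 0 isT); have := inc2 (@o 1 isT); have := inc2 (@o 2 isT); have := inc2 (@o 3 isT).
rewrite S0 S1 S2 S3 => i3 i2 i1 i0.
apply: (@no_flag_cycle (t (@o 0 isT)) (t (@o 1 isT)) (t (@o 2 isT)) (t (@o 3 isT))
  (u (@o 0 isT)) (u (@o 1 isT)) (u (@o 2 isT)) (u (@o 3 isT))) => //.
  by rewrite /= !inE !(inj_eq ui).
by rewrite /= !inE !(inj_eq ti).
Qed.

End DoubledAffinePlane.

Local Open Scope ring_scope.

(** * Selberg's formula *)

Lemma sum_multiples (V : nmodType) (n N : nat) (f : nat -> V) : (0 < n)%N ->
  \sum_(1 <= k < N.+1 | (n %| k)%N) f k =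
  \sum_(1 <= m < (N %/ n).+1) f (n * m)%N.
Proof.
move=> n0; elim: N => [|N IH]; first by rewrite div0n !big_geq.
rewrite big_mkcond big_nat_recr //= -big_mkcond /= IH divnS //.
case: (boolP (n %| N.+1)%N) => dv; last by rewrite addr0 add0n.
rewrite add1n [in RHS]big_nat_recr //=; congr (_ + f _).
by have := divnS N n0; rewrite dv add1n => <-; rewrite mulnC divnK.
Qed.

Lemma sum_divisor_pairs (V : nmodType) (N : nat) (g : nat -> nat -> V) :
  \sum_(1 <= k < N.+1) \sum_(1 <= n < N.+1 | (n %| k)%N) g n k =
  \sum_(1 <= n < N.+1) \sum_(1 <= m < (N %/ n).+1) g n (n * m)%N.
Proof.
under eq_bigr do rewrite big_mkcond.
rewrite exchange_big_nat /=; apply: eq_big_nat => n /andP[n0 _].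
by rewrite -big_mkcond /= sum_multiples.
Qed.

(** Both sides run over the pairs with m * d <= N. *)
Lemma sum_hyperbola_swap (V : nmodType) (N : nat) (g : nat -> nat -> V) :
  \sum_(1 <= m < N.+1) \sum_(1 <= d < (N %/ m).+1) g m d =
  \sum_(1 <= d < N.+1) \sum_(1 <= m < (N %/ d).+1) g m d.
Proof.
have E (h : nat -> nat -> V) m : (0 < m)%N ->
    \sum_(1 <= d < (N %/ m).+1) h m d =
    \sum_(1 <= d < N.+1 | (m * d <= N)%N) h m d.
  move=> m0; rewrite (big_cat_nat (n := (N %/ m).+1) (p := N.+1)) //=; last first.
    by rewrite ltnS leq_div.
  rewrite [X in _ = _ + X]big_nat_cond [X in _ = _ + X]big_pred0 ?addr0; last first.
    move=> d; apply/negbTE; rewrite negb_and -ltnNge negb_and.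
    by rewrite ltn_divLR // [(d * m)%N]mulnC orbAC orNb.
  rewrite big_nat_cond [in RHS]big_nat_cond; apply: eq_bigl => d.
  by rewrite andbT ltnS leq_divRL // mulnC -andbA andbb.
rewrite (eq_big_nat _ _ (F2 := fun m => \sum_(1 <= d < N.+1 | (m * d <= N)%N) g m d));
  last by move=> m /andP[m0 _]; rewrite E.
rewrite [RHS](eq_big_nat _ _ (F2 := fun d => \sum_(1 <= m < N.+1 | (d * m <= N)%N) g m d));
  last by move=> m /andP[m0 _]; rewrite (E (fun a b => g b a)).
under eq_bigr do rewrite big_mkcond.
rewrite exchange_big_nat /=; apply: eq_bigr => d _.
by rewrite [RHS]big_mkcond; apply: eq_bigr => m _; rewrite mulnC.
Qed.

Lemma sum_divisors_widen (V : nmodType) (k N : nat) (f : nat -> V) :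
  (0 < k <= N)%N ->
  \sum_(1 <= d < N.+1 | (d %| k)%N) f d = \sum_(1 <= d < k.+1 | (d %| k)%N) f d.
Proof.
case/andP=> k0 kN; rewrite (big_cat_nat (n := k.+1)) //=.
rewrite [X in _ + X]big_nat_cond [X in _ + X]big_pred0 ?addr0 // => d.
apply/negbTE/negP => /andP[/andP[kd _]] /(dvdn_leq k0).
by rewrite leqNgt kd.
Qed.

(** * The functions of von Mangoldt and Moebius *)

Section vonMangoldt.
Variable R : realType.
Implicit Types n k p N : nat.

(** [primes n] lists the distinct prime divisors, so it is a singleton exactly at the prime
    powers. *)
Definition vonMangoldt n : R :=
  if primes n is [:: p] then ln p%:R else 0.

Local Notation Lam := vonMangoldt.

Lemma vonMangoldt_ge0 n : 0 <= Lam n.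
Proof.
rewrite /Lam; case E: (primes n) => [|p [|q s]] //.
by apply: ln_ge0; have := mem_primes p n; rewrite E inE eqxx => /esym /and3P[/prime_gt0];
  rewrite ler1n.
Qed.

Lemma vonMangoldt_pfactor p k : prime p -> (0 < k)%N -> Lam (p ^ k) = ln p%:R.
Proof. by move=> pp k0; rewrite /Lam primesX // primes_prime. Qed.

Lemma vonMangoldt_neq0 n : Lam n != 0 ->
  exists p k, [/\ prime p, (0 < k)%N & n = (p ^ k)%N].
Proof.
rewrite /Lam; case E: (primes n) => [|p [|q s]]; rewrite ?eqxx // => _.
have /and3P[pp n0 pn] : [&& prime p, 0 < n & p %| n]%N.
  by rewrite -mem_primes E inE.
exists p, (logn p n); split=> //; first by rewrite logn_gt0 E inE.
by rewrite [LHS]prod_prime_decomp // prime_decompE E big_seq1.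
Qed.

(** Induction along n = m * p. The divisors of n that do not divide m contain the full power of p in
    n; the only prime power among them is that power q itself, which contributes ln p. *)
Lemma sum_vonMangoldt n : (0 < n)%N ->
  \sum_(1 <= d < n.+1 | (d %| n)%N) Lam d = ln n%:R.
Proof.
elim/ltn_ind: n => n IH n0.
have [n1|n1] := leqP n 1.
  have -> : n = 1%N by lia.
  by rewrite big_mkcond big_nat1 /= ln1 /Lam.
have [p pp pn] : exists2 p, prime p & (p %| n)%N.
  by exists (pdiv n); rewrite ?pdiv_prime ?pdiv_dvd.
have [m nE] : exists m, n = (m * p)%N by exact/dvdnP.
have m0 : (0 < m)%N by move: n0; rewrite nE muln_gt0 => /andP[].
have p1 := prime_gt1 pp.
have mn : (m < n)%N by rewrite nE -{1}(muln1 m) ltn_pmul2l.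
rewrite (bigID (fun d => d %| m)%N) /=.
have -> : \sum_(1 <= d < n.+1 | (d %| n)%N && (d %| m)%N) Lam d = ln m%:R.
  apply: etrans (IH m mn m0); apply: etrans (@sum_divisors_widen _ m n Lam _); last first.
    by rewrite m0 ltnW.
  apply: eq_bigl => d; rewrite andbC; case: (boolP (d %| m)%N) => //= dm.
  by rewrite nE dvdn_mulr.
pose q := (p ^ (logn p n))%N.
have ln0 : (0 < logn p n)%N by rewrite logn_gt0 mem_primes pp n0.
have lnE : logn p n = (logn p m).+1.
  by rewrite nE lognM ?(prime_gt0 pp) // (logn_prime _ pp) eqxx addn1.
have qn : (q %| n)%N by apply: pfactor_dvdnn.
rewrite (big_rem q) /=; last first.
  by rewrite mem_index_iota ltnS /q expn_gt0 prime_gt0 //= dvdn_leq.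
have qm : ~~ (q %| m)%N by rewrite /q pfactor_dvdn // lnE ltnn.
rewrite qn qm /= {1}/q vonMangoldt_pfactor //.
rewrite big_seq_cond big1 ?addr0; last first.
  move=> d /andP[]; rewrite mem_rem_uniq ?iota_uniq // inE => /andP[dq _] /andP[dn dm].
  apply/eqP; apply: contraR dm => /vonMangoldt_neq0[r [k [pr k0 dE]]].
  move: dn dq; rewrite dE !pfactor_dvdn // nE lognM ?(prime_gt0 pp) // (logn_prime _ pp).
  case: (eqVneq r p) => [-> | _]; last by rewrite addn0.
  rewrite addn1 leq_eqVlt => /orP[/eqP -> |//].
  by rewrite /q lnE eqxx.
by rewrite nE natrM lnM ?posrE ?ltr0n ?(prime_gt0 pp).
Qed.

Definition mobius n : R :=
  if all (fun p => logn p n <= 1)%N (primes n) then (-1) ^+ size (primes n) else 0.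

Lemma norm_mobius_le1 n : `|mobius n| <= 1.
Proof.
by rewrite /mobius; case: ifP => _; rewrite ?normr0 ?ler01 // normrX normrN1 expr1n.
Qed.

Lemma mobius_mul_prime p m : prime p -> (0 < m)%N ->
  mobius (p * m) = if (p %| m)%N then 0 else - mobius m.
Proof.
move=> pp m0; have p0 := prime_gt0 pp.
have pm0 : (0 < p * m)%N by rewrite muln_gt0 p0.
case: ifP => pm.
  rewrite /mobius; case: ifP => // /allP /(_ p).
  rewrite mem_primes pp pm0 dvdn_mulr // lognM // logn_prime // eqxx => /(_ isT).
  have : (0 < logn p m)%N by rewrite logn_gt0 mem_primes pp m0 pm.
  by lia.
have pnm : p \notin primes m by rewrite mem_primes pp m0 pm.
have pe : perm_eq (primes (p * m)) (p :: primes m).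
  apply: uniq_perm; rewrite /= ?primes_uniq ?pnm // => q.
  by rewrite primesM // inE primes_prime // inE.
rewrite /mobius (perm_all _ pe) (perm_size pe) /= lognM // logn_prime // eqxx.
have /eqP -> : logn p m == 0%N by rewrite -leqn0 leqNgt logn_gt0.
rewrite addn0 leqnn /=.
have -> : all (fun q => logn q (p * m) <= 1)%N (primes m) = all (fun q => logn q m <= 1)%N (primes
  m).
  apply: eq_in_all => q qm; rewrite lognM // logn_prime //.
  by case: eqP qm pnm => [-> ->|] //.
by case: ifP; rewrite ?oppr0 // exprS mulN1r.
Qed.

(** With p the least prime factor of k, the divisors p * m with m prime to p cancel against the
    divisors m, and those with p dividing m contribute 0. *)
Lemma sum_mobius k : (0 < k)%N ->
  \sum_(1 <= d < k.+1 | (d %| k)%N) mobius d = (k == 1%N)%:R.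
Proof.
move=> k0; have [k1|k1] := leqP k 1.
  have -> : k = 1%N by lia.
  by rewrite big_mkcond big_nat1 /= /mobius.
rewrite gtn_eqF //=.
have pp := pdiv_prime k1; set p := pdiv k in pp *.
have pk : (p %| k)%N := pdiv_dvd k.
have p0 := prime_gt0 pp.
rewrite (bigID (fun d => p %| d)%N) /=.
under eq_bigl do rewrite andbC.
rewrite big_mkcondr /= (@sum_multiples _ p k (fun d => if (d %| k)%N then mobius d else 0)) //.
have -> : \sum_(1 <= m < (k %/ p).+1) (if (p * m %| k)%N then mobius (p * m) else 0) =
   \sum_(1 <= m < (k %/ p).+1 | (m %| k)%N && ~~ (p %| m)%N) - mobius m.
  rewrite [RHS]big_mkcond; apply: eq_big_nat => m /andP[m0 _].
  rewrite mobius_mul_prime //; case: (boolP (p %| m)%N) => pm /=.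
    by rewrite andbF; case: ifP.
  by rewrite andbT Gauss_dvd ?pk // prime_coprime.
rewrite sumrN addrC; apply/eqP; rewrite subr_eq0; apply/eqP.
rewrite (big_cat_nat (n := (k %/ p).+1)) //=; last by rewrite ltnS leq_div.
rewrite [X in _ + X]big_nat_cond [X in _ + X]big_pred0 ?addr0 // => d.
apply/negbTE/negP => /andP[/andP[kd dk]] /andP[dvk pnd].
have : (p * d %| k)%N by rewrite Gauss_dvd ?pk ?dvk // prime_coprime.
move/(dvdn_leq k0); rewrite leqNgt mulnC => /negP; apply.
by rewrite -ltn_divLR.
Qed.

(** Expand ln k - ln d = ln (k / d) as a sum of [Lam e] over the divisors e of k / d and exchange:
    the inner Moebius sum over the divisors of k / e vanishes unless e = k. *)
Lemma sum_mobius_ln k : (0 < k)%N ->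
  \sum_(1 <= d < k.+1 | (d %| k)%N) mobius d * ln d%:R = - Lam k.
Proof.
move=> k0.
suff : \sum_(1 <= d < k.+1 | (d %| k)%N) mobius d * (ln k%:R - ln d%:R) = Lam k.
  under eq_bigr do rewrite mulrBr.
  rewrite sumrB -mulr_suml sum_mobius // => <-.
  by case: eqP => [->|_]; rewrite ?ln1 ?mulr0 ?mul0r sub0r opprK.
transitivity (\sum_(1 <= d < k.+1) \sum_(1 <= e < k.+1 | (d * e %| k)%N) mobius d * Lam e).
  rewrite big_mkcond; apply: eq_big_nat => d /andP[d0 dk].
  case: ifP => dvk; last first.
    by rewrite big1 // => e /(dvdn_trans (dvdn_mulr e (dvdnn d))); rewrite dvk.
  have kd0 : (0 < k %/ d)%N by rewrite divn_gt0.
  rewrite -ln_div ?posrE ?ltr0n // -[(_ / _)]/(_ * _) -natf_div //.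
  rewrite -sum_vonMangoldt // -(@sum_divisors_widen _ _ k Lam) ?kd0 ?leq_div //.
  rewrite mulr_sumr; apply: eq_bigl => e.
  by rewrite dvdn_divRL // mulnC.
under eq_bigr do rewrite big_mkcond.
rewrite exchange_big_nat /=.
rewrite (big_rem k) /=; last by rewrite mem_index_iota k0 ltnSn.
rewrite [X in _ + X]big_seq_cond [X in _ + X]big1 ?addr0; last first.
  move=> e; rewrite mem_rem_uniq ?iota_uniq // inE mem_index_iota andbT => /andP[ek /andP[e0 _]].
  rewrite -big_mkcond /=.
  case: (boolP (e %| k)%N) => ek'; last first.
    by rewrite big1 // => d dk; case/negP: ek'; apply: dvdn_trans dk; rewrite dvdn_mull.
  have ke0 : (0 < k %/ e)%N by rewrite divn_gt0 // dvdn_leq.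
  rewrite -mulr_suml.
  have -> : \sum_(1 <= d < k.+1 | (d * e %| k)%N) mobius d = \sum_(1 <= d < k.+1 | (d %| k %/ e)%N)
    mobius d.
    by apply: eq_bigl => d; rewrite dvdn_divRL.
  rewrite sum_divisors_widen ?ke0 ?leq_div // sum_mobius //.
  rewrite -(eqn_pmul2r e0) divnK // mul1n eq_sym (negbTE ek) mul0r //.
rewrite -big_mkcond /= -mulr_suml.
have -> : \sum_(1 <= d < k.+1 | (d * k %| k)%N) mobius d = \sum_(1 <= d < k.+1 | (d %| 1)%N) mobius
  d.
  by apply: eq_bigl => d; rewrite -{2}(mul1n k) dvdn_pmul2r.
by rewrite sum_divisors_widen // sum_mobius // mul1r.
Qed.

Definition chebyshev_psi (N : nat) : R := \sum_(1 <= n < N.+1) Lam n.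

(** Legendre's formula in logarithmic form: d divides [N %/ d] of the numbers up to N. *)
Lemma ln_fact_vonMangoldt N :
  ln N`!%:R = \sum_(1 <= d < N.+1) Lam d * (N %/ d)%:R.
Proof.
transitivity (\sum_(1 <= k < N.+1) (ln k%:R : R)).
  elim: N => [|N IH]; first by rewrite big_geq // fact0 ln1.
  by rewrite big_nat_recr //= -IH factS natrM lnM ?posrE ?ltr0n ?fact_gt0 // addrC.
transitivity (\sum_(1 <= k < N.+1) \sum_(1 <= n < N.+1 | (n %| k)%N) Lam n).
  apply: eq_big_nat => k /andP[k0 kN]; rewrite -sum_vonMangoldt //.
  by apply/esym/sum_divisors_widen; rewrite k0.
rewrite sum_divisor_pairs; apply: eq_bigr => d _.
by rewrite sumr_const_nat subSS subn0 mulr_natr.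
Qed.

Lemma sum_psi_div N : \sum_(1 <= m < N.+1) chebyshev_psi (N %/ m) = ln N`!%:R.
Proof.
rewrite ln_fact_vonMangoldt /chebyshev_psi sum_hyperbola_swap; apply: eq_bigr => d _.
by rewrite sumr_const_nat subSS subn0 mulr_natr.
Qed.

End vonMangoldt.

(** * Estimates of Chebyshev, Mertens and Selberg *)

Section Estimates.
Variable R : realType.
Implicit Types (n k N M : nat) (x y : R).

Lemma ln_le_sub1 x : 0 < x -> ln x <= x - 1.
Proof. by move=> x0; have := @le_ln1Dx R (x - 1); rewrite [1 + _]addrC subrK; apply; lra. Qed.

Lemma ln_le_linear (e x : R) : 0 < e -> 0 < x -> ln x <= e * x - ln e.
Proof.
move=> e0 x0; have := @ln_le_sub1 (e * x); rewrite lnM ?posrE // mulr_gt0 //.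
by move=> /(_ isT); lra.
Qed.

Lemma ln_succ_bounds n : (0 < n)%N ->
  n.+1%:R^-1 <= ln n.+1%:R - ln n%:R :> R /\ ln n.+1%:R - ln n%:R <= n%:R^-1 :> R.
Proof.
move=> n0; have nR : 0 < n%:R :> R by rewrite ltr0n.
have n1R : 0 < n.+1%:R :> R by rewrite ltr0n.
split; last first.
  rewrite -ln_div ?posrE //; apply: le_trans (ln_le_sub1 _) _; first by rewrite divr_gt0.
  by rewrite -natr1 mulrDl divff ?gt_eqF // mul1r addrAC subrr add0r.
rewrite -[X in _ <= X]opprB -ln_div ?posrE // lerNr.
apply: le_trans (ln_le_sub1 _) _; first by rewrite divr_gt0.
have -> : n%:R = n.+1%:R - 1 :> R by rewrite -natr1 addrK.
by rewrite mulrBl divff ?gt_eqF // mul1r addrAC subrr add0r.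
Qed.

Lemma ln2_bounds : 1 / 2 <= ln 2 :> R /\ ln 2 <= 3 / 4 :> R.
Proof.
split.
  by have [+ _] := @ln_succ_bounds 1 isT; rewrite ln1 subr0 mul1r.
(* (9 / 8) ^ 6 exceeds 2, and ln (9 / 8) <= 1 / 8, so ln 2 <= 6 / 8. *)
have h : ln 2 <= ln ((9 / 8) ^+ 6) :> R.
  by rewrite ler_ln ?posrE ?exprn_gt0 ?ltr0n //; lra.
apply: le_trans h _; rewrite lnXn; last lra.
by have := @ln_le_sub1 (9 / 8); rewrite -mulr_natr => /(_ ltac:(lra)); lra.
Qed.

Definition harmonic_sum N : R := \sum_(1 <= m < N.+1) m%:R^-1.

Lemma harmonic_sumS N : harmonic_sum N.+1 = harmonic_sum N + N.+1%:R^-1.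
Proof. by rewrite /harmonic_sum big_nat_recr. Qed.

Lemma harmonic_sum_le N : (0 < N)%N -> harmonic_sum N <= 1 + ln N%:R.
Proof.
elim: N => // -[_ _|N IH _].
  by rewrite /harmonic_sum big_nat1 ln1 addr0 invr1.
rewrite harmonic_sumS; have [l1 _] := @ln_succ_bounds N.+1 isT; move: (IH isT) l1.
by move: (ln N.+2%:R) (ln N.+1%:R) (N.+2%:R^-1) => a b c; lra.
Qed.

(** Euler's constant, as the supremum of the increasing sequence [v]; the decreasing sequence [u]
    bounds it from above and controls the error. *)
Lemma harmonic_sum_gamma : exists2 g : R, 0 <= g <= 1 &
  forall N, (0 < N)%N -> 0 <= harmonic_sum N - ln N%:R - g <= N%:R^-1.
Proof.
pose v N := harmonic_sum N - ln N.+1%:R; pose u N := harmonic_sum N.+1 - ln N.+1%:R.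
have v_nd : {homo v : m n / (m <= n)%N >-> m <= n}.
  apply: homo_leq => // [? ? ? ab|n]; first exact: le_trans.
  rewrite /v harmonic_sumS; have [_] := @ln_succ_bounds n.+1 isT.
  by move: (ln n.+2%:R) (ln n.+1%:R) (n.+1%:R^-1) => a b c; lra.
have u_ni n m : u (n + m)%N <= u n.
  elim: m => [|m IH]; first by rewrite addn0.
  apply: le_trans IH; rewrite addnS /u [X in X - _ <= _]harmonic_sumS.
  have [+ _] := @ln_succ_bounds (n + m).+1 isT.
  by move: (ln (n + m).+2%:R) (ln (n + m).+1%:R) ((n + m).+2%:R^-1) => a b c; lra.
have vu m n : v m <= u n.
  have le1 : v m <= v (n + m).+1 by apply: v_nd; rewrite leqW // leq_addl.
  apply: le_trans le1 _; apply: le_trans (u_ni n m).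
  rewrite /v /u lerD2l lerN2 ler_ln ?posrE ?ltr0n // ler_nat //.
pose E := [set v n | n in [set: nat]]%classic.
have E0 : (E !=set0)%classic by exists (v 0); exists 0%N.
have Eub n : ubound E (u n) by move=> _ [m _ <-].
have hE : has_sup E by split=> //; exists (u 0); exact: Eub.
have g1 n : v n <= sup E by apply: sup_upper_bound => //; exists n.
have g2 n : sup E <= u n by apply: ge_sup.
exists (sup E).
  have := g1 0%N; have := g2 0%N; rewrite /v /u /harmonic_sum big_nat1 big_geq // ln1 invr1; lra.
case=> // N _; have := g2 N; have := g1 N.+1; rewrite /v /u.
have [_] := @ln_succ_bounds N.+1 isT.
by move: (ln N.+2%:R) (ln N.+1%:R) (N.+1%:R^-1) => a b c; lra.
Qed.

Lemma ln_fact_bounds N : (0 < N)%N ->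
  0 <= ln N`!%:R - (N%:R * ln N%:R - N%:R + 1 : R) <= 1 + ln N%:R.
Proof.
(* The induction carries the error [harmonic_sum N], whose increment is what a single step can
   lose. *)
move=> N0; have H : 0 <= ln N`!%:R - (N%:R * ln N%:R - N%:R + 1 : R) <= harmonic_sum N.
  elim: N N0 => // -[_ _|N IH _].
    by rewrite /harmonic_sum big_nat1 (_ : 1`! = 1)%N // !ln1 invr1; lra.
  rewrite factS natrM lnM ?posrE ?ltr0n ?fact_gt0 // harmonic_sumS.
  have := IH isT; have [l1 l2] := @ln_succ_bounds N.+1 isT.
  set L2 := ln N.+2%:R in l1 l2 *; set L1 := ln N.+1%:R in l1 l2 *.
  set F := ln _ => {}IH.
  have p1 : 0 < N.+1%:R :> R by rewrite ltr0n.
  have p2 : 0 < N.+2%:R :> R by rewrite ltr0n.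
  have E : N.+2%:R = N.+1%:R + 1 :> R by rewrite -natr1.
  have a1 : N.+1%:R * (L2 - L1) <= 1 by rewrite -ler_pdivlMl // mulr1.
  have a2 : 1 - N.+2%:R^-1 <= N.+1%:R * (L2 - L1).
    apply: le_trans (_ : N.+1%:R * N.+2%:R^-1 <= _); last by rewrite ler_pM2l.
    have -> : N.+1%:R = N.+2%:R - 1 :> R by rewrite E addrK.
    by rewrite mulrBl divff ?gt_eqF // mul1r.
  rewrite E in a2 *; move: a1 a2 IH; set w := N.+1%:R; set z := (w + 1)^-1.
  by move=> a1 a2 /andP[b1 b2]; apply/andP; split; nra.
by have := harmonic_sum_le N0; lra.
Qed.

Local Notation Lam := (@vonMangoldt R).
Local Notation psi := (@chebyshev_psi R).

Lemma psi_ge0 N : 0 <= psi N.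
Proof. by apply: sumr_ge0 => i _; apply: vonMangoldt_ge0. Qed.

Lemma psi_homo : {homo psi : m n / (m <= n)%N >-> m <= n}.
Proof.
move=> m n mn; rewrite /chebyshev_psi [X in _ <= X](big_cat_nat (n := m.+1)) //= lerDl.
by apply: sumr_ge0 => i _; apply: vonMangoldt_ge0.
Qed.

(** Chebyshev's comparison: in Legendre's formula the coefficient of [Lam d] becomes the parity of
    [N %/ d], which is 0 or 1, and is 1 for N / 2 < d <= N. *)
Lemma ln_fact_halves N :
  psi N - psi (N %/ 2) <= ln N`!%:R - 2 * ln (N %/ 2)`!%:R <= psi N.
Proof.
have E : ln (N %/ 2)`!%:R = \sum_(1 <= d < N.+1) Lam d * (N %/ 2 %/ d)%:R.
  rewrite ln_fact_vonMangoldt [RHS](big_cat_nat (n := (N %/ 2).+1)) //=;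
    last by rewrite ltnS leq_div.
  rewrite [X in _ = _ + X]big_nat_cond [X in _ = _ + X]big1 ?addr0 // => d /andP[/andP[dN _] _].
  by rewrite divn_small // mulr0.
have oddE d : (N %/ d)%:R - 2 * (N %/ 2 %/ d)%:R = (odd (N %/ d))%:R :> R.
  rewrite -divnMA mulnC divnMA divn2; set q := (N %/ d)%N.
  by rewrite -{1}(odd_double_half q) natrD -muln2 natrM; lra.
have -> : ln N`!%:R - 2 * ln (N %/ 2)`!%:R = \sum_(1 <= d < N.+1) Lam d * (odd (N %/ d))%:R.
  rewrite E ln_fact_vonMangoldt mulr_sumr -sumrB; apply: eq_bigr => d _.
  by rewrite -oddE mulrBr mulrCA.
apply/andP; split; last first.
  apply: ler_sum => d _; rewrite ler_piMr ?vonMangoldt_ge0 //.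
  by case: odd; rewrite ?ler01.
rewrite [X in _ <= X](big_cat_nat (n := (N %/ 2).+1)) //=; last by rewrite ltnS leq_div.
have -> : psi N - psi (N %/ 2) = \sum_((N %/ 2).+1 <= d < N.+1) Lam d.
  rewrite /chebyshev_psi [X in X - _](big_cat_nat (n := (N %/ 2).+1)) //=;
    last by rewrite ltnS leq_div.
  by rewrite addrAC subrr add0r.
rewrite -[X in X <= _]add0r; apply: lerD.
  by apply: sumr_ge0 => d _; rewrite mulr_ge0 ?vonMangoldt_ge0.
apply: ler_sum_nat => d /andP[d1 d2].
have d0 : (0 < d)%N by lia.
suff -> : (N %/ d = 1)%N by rewrite mulr1.
apply/eqP; rewrite eqn_leq; apply/andP; split; last by rewrite divn_gt0.
by rewrite -ltnS ltn_divLR //; lia.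
Qed.

Lemma ln_fact_halves_bounds N : (1 < N)%N ->
  N%:R * ln 2 - 4 - 2 * ln N%:R <= ln N`!%:R - 2 * ln (N %/ 2)`!%:R :> R /\
  ln N`!%:R - 2 * ln (N %/ 2)`!%:R <= N%:R * ln 2 + 2 * ln N%:R :> R.
Proof.
move=> N1; set M := (N %/ 2)%N.
have M0 : (0 < M)%N by rewrite divn_gt0.
have key : (2 * M)%:R * ln 2 - 3 - 2 * ln M%:R <= ln (2 * M)`!%:R - 2 * ln M`!%:R :> R /\
  ln (2 * M)`!%:R - 2 * ln M`!%:R <= (2 * M)%:R * ln 2 + ln (2 * M)%:R :> R.
  have MM : (0 < 2 * M)%N by rewrite muln_gt0.
  have := ln_fact_bounds M0; have := ln_fact_bounds MM.
  have E2 : (2 * M)%:R = 2 * M%:R :> R by rewrite natrM.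
  rewrite E2 lnM ?posrE ?ltr0n //; move: (M%:R) (ln (2 * M)`!%:R) (ln M`!%:R) (ln M%:R) (ln 2) => m
    a b c d.
  by move=> /andP[h1 h2] /andP[h3 h4]; split; nra.
have [ln2a ln2b] := ln2_bounds.
have lnMN : ln M%:R <= ln N%:R :> R by rewrite ler_ln ?posrE ?ltr0n ?ler_nat ?leq_div //; lia.
have lnM2 : ln (2 * M)%:R <= ln N%:R :> R.
  by rewrite ler_ln ?posrE ?ltr0n ?ler_nat /M //; lia.
have lnN0 : 0 <= ln N%:R :> R by rewrite ln_ge0 // ler1n; lia.
have [e|e] : (N = 2 * M \/ N = (2 * M).+1)%N by rewrite /M; lia.
  by move: key; rewrite -e => -[]; split; lra.
have F : ln N`!%:R = ln N%:R + ln (2 * M)`!%:R :> R.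
  by rewrite {1}e factS -e natrM lnM ?posrE ?ltr0n ?fact_gt0 //; lia.
have E : N%:R * ln 2 = (2 * M)%:R * ln 2 + ln 2 :> R by rewrite {1}e -natr1 mulrDl mul1r.
by rewrite F E; case: key => h1 h2; split; lra.
Qed.

(** Induction from [N %/ 2] to N, a step costing at most (3 / 4) N + O(ln N). The slope 8 / 5
    exceeds 2 * (3 / 4), which absorbs the logarithm beyond N0, and lies far enough below 2 for the
    contradiction in [full_density_absurd]. *)
Lemma psi_upper : exists K : R, forall N, psi N <= 8 / 5 * N%:R + K.
Proof.
have [ln2a ln2b] := ln2_bounds.
pose N0 := (Num.truncn ((- 2 * ln (1 / 100)) * 100 : R)).+2.
exists (psi N0); elim/ltn_ind => N IH.
have [NN|NN] := leqP N N0.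
  by apply: le_trans (psi_homo NN) _; rewrite lerDr mulr_ge0.
have N1 : (1 < N)%N by rewrite /N0 in NN; lia.
have NR : 0 < N%:R :> R by rewrite ltr0n; lia.
have /andP[h _] := ln_fact_halves N; have [_ h2] := ln_fact_halves_bounds N1.
have h3 := IH (N %/ 2)%N ltac:(lia).
have h4 : (N %/ 2)%:R <= N%:R / 2 :> R.
  by rewrite ler_pdivlMr // -natrM ler_nat leq_trunc_div.
have h5 := @ln_le_linear (1 / 100) N%:R ltac:(lra) NR.
have h6 : (- 2 * ln (1 / 100)) * 100 <= N%:R :> R.
  apply: ltW; apply: lt_le_trans (truncnS_gt _) _; rewrite ler_nat.
  by apply: (ltn_trans _ NN); rewrite /N0 ltnS; exact: leqnSn.
nra.
Qed.

Lemma psi_lower : exists K : R, forall N, 2 / 5 * N%:R - K <= psi N.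
Proof.
have [ln2a ln2b] := ln2_bounds.
exists (5 - 2 * ln (1 / 100)) => N.
have hl : ln (1 / 100) <= 0 :> R by apply: ln_le0; lra.
have [N1|N1] := leqP N 1.
  have := psi_ge0 N; have : N%:R <= 1 :> R by rewrite lern1.
  lra.
have NR : 0 < N%:R :> R by rewrite ltr0n; lia.
have /andP[_ h] := ln_fact_halves N; have [h2 _] := ln_fact_halves_bounds N1.
have h5 := @ln_le_linear (1 / 100) N%:R ltac:(lra) NR.
nra.
Qed.

(** Replacing [N %/ d] by N / d in Legendre's formula changes ln N! by at most psi N = O(N); compare
    with Stirling and divide by N. *)
Lemma Mertens : exists K : R, forall N, (0 < N)%N ->
  `|\sum_(1 <= d < N.+1) Lam d / d%:R - ln N%:R| <= K.
Proof.
have [K hK] := psi_upper.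
exists (6 + `|K|) => N N0; have NR : 1 <= N%:R :> R by rewrite ler1n.
set S := \sum_(_ <= _ < _) _.
have h1 : ln N`!%:R <= N%:R * S.
  rewrite ln_fact_vonMangoldt /S mulr_sumr; apply: ler_sum_nat => d /andP[d0 _].
  rewrite mulrCA ler_wpM2l ?vonMangoldt_ge0 // ler_pdivlMr ?ltr0n //.
  by rewrite -natrM ler_nat leq_trunc_div.
have h2 : N%:R * S - psi N <= ln N`!%:R.
  rewrite ln_fact_vonMangoldt /S mulr_sumr /chebyshev_psi -sumrB;
    apply: ler_sum_nat => d /andP[d0 _].
  rewrite mulrCA -{2}(mulr1 (Lam d)) -mulrBr ler_wpM2l ?vonMangoldt_ge0 //.
  rewrite lerBlDr ler_pdivrMr ?ltr0n // natr1 -natrM ler_nat.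
  by apply/ltnW/ltn_ceil.
have := ln_fact_bounds N0; have := hK N; have := ler_norm K.
have := @ln_le_sub1 N%:R ltac:(lra).
have := psi_ge0 N; have : 0 <= ln N%:R :> R by apply: ln_ge0.
move: (ln N%:R) h1 h2 => L h1 h2 l0 p0 l1 k0 p1 /andP[f1 f2].
rewrite ler_norml; apply/andP; split.
  have : N%:R * (L - 1) <= N%:R * S by nra.
  by rewrite ler_pM2l; have := normr_ge0 K; lra.
have n0 := normr_ge0 K.
have : N%:R * S <= N%:R * (L + 6 + `|K|) by nra.
by rewrite ler_pM2l; lra.
Qed.

Lemma sqrt_sum_le N : \sum_(1 <= n < N.+1) (Num.sqrt n%:R)^-1 <= 2 * Num.sqrt N%:R :> R.
Proof.
elim: N => [|N IH]; first by rewrite big_geq // sqrtr0 mulr0.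
rewrite big_nat_recr //=; apply: le_trans (lerD IH (lexx _)) _.
have s1 : 0 < Num.sqrt N.+1%:R :> R by rewrite sqrtr_gt0 ltr0n.
have s0 : 0 <= Num.sqrt N%:R :> R by rewrite sqrtr_ge0.
have e1 : Num.sqrt N.+1%:R ^+ 2 = N%:R + 1 :> R by rewrite sqr_sqrtr // natr1.
have e0 : Num.sqrt N%:R ^+ 2 = N%:R :> R by rewrite sqr_sqrtr.
rewrite -(ler_pM2r s1) mulrDl mulVf ?gt_eqF //.
move: (Num.sqrt N.+1%:R) (Num.sqrt N%:R) s1 s0 e1 e0 => a b; nra.
Qed.

Lemma ln_le_sqrt x : 1 <= x -> ln x <= 2 * Num.sqrt x /\ ln x ^+ 2 <= 16 * Num.sqrt x.
Proof.
move=> x1; have x0 : 0 < x by lra.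
have s0 : 0 < Num.sqrt x by rewrite sqrtr_gt0.
have e : x = Num.sqrt x ^+ 2 by rewrite sqr_sqrtr // ltW.
have q0 : 0 < Num.sqrt (Num.sqrt x) by rewrite sqrtr_gt0.
have e2 : Num.sqrt x = Num.sqrt (Num.sqrt x) ^+ 2 by rewrite sqr_sqrtr // ltW.
have l1 : ln x = 2 * ln (Num.sqrt x) by rewrite {1}e lnXn // mulr_natl.
have l2 : ln (Num.sqrt x) = 2 * ln (Num.sqrt (Num.sqrt x)) by rewrite {1}e2 lnXn // mulr_natl.
have := ln_sublinear s0; have := ln_sublinear q0; have := ln_ge0 x1.
by split; nra.
Qed.

Lemma Selberg_nat : exists K : R, forall N, (0 < N)%N ->
  `|psi N * ln N%:R + \sum_(1 <= n < N.+1) Lam n * psi (N %/ n) - 2 * N%:R * ln N%:R| <= K * N%:R.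
Proof.
have [g g01 hg] := harmonic_sum_gamma.
have [K1 hK1] := psi_upper; have [K2 hK2] := Mertens.
exists (200 + 10 * `|K1| + `|K2|) => N N0.
have NR : 1 <= N%:R :> R by rewrite ler1n.
have N0R : 0 < N%:R :> R by rewrite ltr0n.
(* Tatuzawa-Iseki: Moebius inversion weighted by a logarithm; the constant g + 1 makes the inner
   sums over multiples logarithmically small. *)
pose F k : R := psi (N %/ k) - N%:R / k%:R + (g + 1).
pose S : R := \sum_(1 <= n < N.+1) mobius R n * (ln N%:R - ln n%:R) *
      \sum_(1 <= m < (N %/ n).+1) F (n * m)%N.
(* Collect by k = n * m. The constant part ln N of the weight leaves only k = 1, and the part ln n
   leaves [Lam k]. *)
have SE : S = F 1%N * ln N%:R + \sum_(1 <= k < N.+1) F k * Lam k.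
  transitivity (\sum_(1 <= k < N.+1) \sum_(1 <= n < N.+1 | (n %| k)%N)
     mobius R n * (ln N%:R - ln n%:R) * F k).
    by rewrite sum_divisor_pairs; apply: eq_bigr => n _; rewrite mulr_sumr.
  transitivity (\sum_(1 <= k < N.+1) (F k * ((k == 1%N)%:R * ln N%:R) + F k * Lam k)).
    apply: eq_big_nat => k /andP[k0 kN]; rewrite sum_divisors_widen ?k0 // -mulr_suml.
    under eq_bigr do rewrite mulrBr.
    by rewrite sumrB -mulr_suml sum_mobius // sum_mobius_ln // opprK -mulrDr mulrC.
  rewrite big_split /=; congr (_ + _).
  rewrite big_ltn // eqxx mul1r big_nat_cond big1 ?addr0 // => k /andP[/andP[k1 _] _].
  by rewrite gtn_eqF // mul0r mulr0.
(* With y = N / n and M its integer part, Stirling and Euler's constant reduce the sum to (M - y)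
   (ln M + g) up to a logarithmic error, and y - M lies between 0 and 1. *)
have FS n : (0 < n <= N)%N ->
    `|\sum_(1 <= m < (N %/ n).+1) F (n * m)%N| <= 2 * ln (N%:R / n%:R) + 6.
  case/andP=> n0 nN; set M := (N %/ n)%N; set y := N%:R / n%:R.
  have nR : 0 < n%:R :> R by rewrite ltr0n.
  have M0 : (0 < M)%N by rewrite divn_gt0.
  have MR : 1 <= M%:R :> R by rewrite ler1n.
  have My : M%:R <= y by rewrite ler_pdivlMr // -natrM ler_nat leq_trunc_div.
  have yM : y <= M%:R + 1 by rewrite ler_pdivrMr // natr1 -natrM ler_nat ltnW // ltn_ceil.
  have -> : \sum_(1 <= m < M.+1) F (n * m)%N =
      ln M`!%:R - y * harmonic_sum M + M%:R * (g + 1).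
    rewrite /F big_split /= sumrB -sum_psi_div /harmonic_sum mulr_sumr.
    congr (_ - _ + _).
    - by apply: eq_bigr => m _; rewrite divnMA.
    - by apply: eq_bigr => m _; rewrite /y natrM invfM mulrA.
    - by rewrite sumr_const_nat subSS subn0 mulr_natl.
  have lM : 0 <= ln M%:R :> R by apply: ln_ge0.
  have lMy : ln M%:R <= ln y by rewrite ler_ln ?posrE; lra.
  have MV : M%:R * M%:R^-1 = 1 :> R by rewrite divff // gt_eqF //; lra.
  have := hg M M0; have := ln_fact_bounds M0.
  have V0 : 0 <= M%:R^-1 :> R by rewrite invr_ge0.
  move: (harmonic_sum M) (ln M`!%:R) => h f /andP[f1 f2] /andP[h1 h2].
  have yV : y * M%:R^-1 <= 2 by nra.
  have z1 : 0 <= y * (h - ln M%:R - g) <= 2.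
    by apply/andP; split; [apply: mulr_ge0; lra | apply: le_trans yV; rewrite ler_pM2l //; lra].
  have z2 : 0 <= (y - M%:R) * (ln M%:R + g) <= ln M%:R + 1.
    by apply/andP; split; [apply: mulr_ge0; lra | nra].
  rewrite ler_norml; apply/andP; split; nra.
(* Each term is at most ln y (2 ln y + 6) with y = N / n, and [ln_le_sqrt] bounds this by (2 * 16 +
   6 * 2) sqrt y = 44 sqrt y. *)
have Sb : `|S| <= 150 * N%:R.
  apply: le_trans (ler_norm_sum _ _ _) _.
  apply: le_trans (_ : \sum_(1 <= n < N.+1) 44 * Num.sqrt N%:R * (Num.sqrt n%:R)^-1 <= _);
    last first.
    rewrite -mulr_sumr; have := sqrt_sum_le N.
    have : Num.sqrt N%:R * Num.sqrt N%:R = N%:R :> R by rewrite -expr2 sqr_sqrtr.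
    have := sqrtr_ge0 (N%:R : R).
    by move: (Num.sqrt N%:R) (\sum_(_ <= _ < _) _) => a b; nra.
  apply: ler_sum_nat => n /andP[n0 nN].
  have nR : 0 < n%:R :> R by rewrite ltr0n.
  have -> : 44 * Num.sqrt N%:R * (Num.sqrt n%:R)^-1 = 44 * Num.sqrt (N%:R / n%:R) :> R.
    by rewrite sqrtrM // sqrtrV // mulrA.
  rewrite -ln_div ?posrE // !normrM.
  have y1 : 1 <= N%:R / n%:R :> R by rewrite ler_pdivlMr // mul1r ler_nat.
  have [l1 l2] := ln_le_sqrt y1; have l0 := ln_ge0 y1.
  have := FS n; rewrite n0 -ltnS nN => /(_ isT) h.
  rewrite -mulrA; apply: le_trans (ler_piMl _ (norm_mobius_le1 R n)) _; first by rewrite mulr_ge0.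
  rewrite (ger0_norm l0); apply: le_trans (ler_wpM2l l0 h) _; nra.
have := hK1 N; have := hK2 N N0; have := psi_ge0 N.
have lN : 0 <= ln N%:R :> R by apply: ln_ge0.
have := @ln_le_sub1 N%:R N0R.
have E : \sum_(1 <= k < N.+1) F k * Lam k = \sum_(1 <= n < N.+1) Lam n * psi (N %/ n)
   - N%:R * \sum_(1 <= d < N.+1) Lam d / d%:R + (g + 1) * psi N.
  rewrite /F mulr_sumr /chebyshev_psi mulr_sumr -sumrB -big_split /=; apply: eq_bigr => k _.
  by rewrite mulrDl mulrBl; congr (_ - _ + _); rewrite ?(mulrC _ (Lam k)) // mulrCA.
move: SE Sb; rewrite E /F divn1 divr1 => ->.
set P := psi N; set L := ln N%:R; set A := \sum_(_ <= n < _) _ * _.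
set B := \sum_(_ <= d < _) _ / _.
rewrite !ler_norml => /andP[s1 s2] l1 p0 /andP[b1 b2] p1.
have k1 := ler_norm K1; have k1' := normr_ge0 K1; have k2 := ler_norm K2; have k2' := normr_ge0 K2.
have b1' : - (N%:R * `|K2|) <= N%:R * (B - L) by rewrite -mulrN ler_pM2l //; lra.
have b2' : N%:R * (B - L) <= N%:R * `|K2| by rewrite ler_pM2l //; lra.
have p2 : (g + 1) * P <= 2 * P by nra.
have p3 : 0 <= (g + 1) * P by rewrite mulr_ge0 //; lra.
have p4 : 0 <= (g + 1) * L by rewrite mulr_ge0 //; lra.
have p4' : (g + 1) * L <= 2 * L by rewrite ler_wpM2r //; lra.
have p5 : P <= (8 / 5 + `|K1|) * N%:R by nra.
have p6 : 0 <= `|K1| * N%:R by rewrite mulr_ge0.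
by apply/andP; split; lra.
Qed.

End Estimates.

(** * Prime powers in short intervals *)

Section ErdosGaps.
Variable R : realType.
Implicit Types (n k N M : nat) (x y z s : R).
Local Notation Lam := (@vonMangoldt R).

Lemma truncn_div_nat x n : 0 <= x -> (0 < n)%N ->
  Num.truncn (x / n%:R) = (Num.truncn x %/ n)%N.
Proof.
move=> x0 n0; have nR : 0 < n%:R :> R by rewrite ltr0n.
apply: truncn_def; rewrite ler_pdivlMr // ltr_pdivrMr // -!natrM.
have /andP[t1 t2] := truncn_itv x0; apply/andP; split.
  by apply: le_trans t1; rewrite ler_nat leq_trunc_div.
by apply: lt_le_trans t2 _; rewrite ler_nat ltn_ceil.
Qed.

Definition psiR x : R := chebyshev_psi R (Num.truncn x).

Lemma psiR_ge0 x : 0 <= psiR x.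
Proof. exact: psi_ge0. Qed.

Lemma psiR_homo x y : x <= y -> psiR x <= psiR y.
Proof. by move=> xy; apply: psi_homo; apply: le_truncn. Qed.

Lemma psiR_lt1 x : x < 1 -> psiR x = 0.
Proof.
move=> x1; rewrite /psiR.
have /truncn0Pn -> : ~~ (1 <= x) by rewrite -ltNge.
by rewrite /chebyshev_psi big_geq.
Qed.

Lemma psiR_upper : exists K, forall x, 0 <= x -> psiR x <= 8 / 5 * x + K.
Proof.
have [K hK] := psi_upper R; exists K => x x0; apply: le_trans (hK _) _.
by have := truncn_le x; rewrite x0; lra.
Qed.

Lemma psiR_linear : exists2 K : R, 0 < K & forall x, 0 <= x -> psiR x <= K * x.
Proof.
have [K hK] := psiR_upper; exists (8 / 5 + `|K|); first by have := normr_ge0 K; lra.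
move=> x x0; have [x1|x1] := ltP x 1.
  by rewrite psiR_lt1 // mulr_ge0 //; have := normr_ge0 K; lra.
by have := hK x x0; have := normr_ge0 K; have := ler_norm K; nra.
Qed.

Lemma psiR_lower : exists K, forall x, 0 <= x -> 2 / 5 * x - K <= psiR x.
Proof.
have [K hK] := psi_lower R; exists (K + 1) => x x0; apply: le_trans (hK _).
by have := truncnS_gt x; rewrite -natr1; lra.
Qed.

Lemma ln_truncn x : 1 <= x ->
  [/\ (0 < Num.truncn x)%N, 1 <= (Num.truncn x)%:R :> R, (Num.truncn x)%:R <= x,
      x < (Num.truncn x)%:R + 1 & 0 <= ln x - ln (Num.truncn x)%:R <= (Num.truncn x)%:R^-1].
Proof.
move=> x1; have x0 : 0 <= x by lra.
have /andP[t1 t2] := truncn_itv x0; rewrite -natr1 in t2.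
have n0 : (0 < Num.truncn x)%N by rewrite truncn_gt0.
have n1 : 1 <= (Num.truncn x)%:R :> R by rewrite ler1n.
split=> //; apply/andP; split; first by rewrite subr_ge0 ler_ln ?posrE //; lra.
rewrite -ln_div ?posrE; try lra.
apply: le_trans (ln_le_sub1 _) _; first by rewrite divr_gt0; lra.
rewrite lerBlDr ler_pdivrMr; last lra.
by rewrite mulrDl mulVf ?mul1r; [lra | rewrite gt_eqF //; lra].
Qed.

Definition mertens_sum x : R := \sum_(1 <= n < (Num.truncn x).+1) Lam n / n%:R.

Lemma MertensR : exists2 K : R, 0 < K & forall x, 1 <= x -> `|mertens_sum x - ln x| <= K.
Proof.
have [K hK] := Mertens R; exists (`|K| + 1); first by have := normr_ge0 K; lra.
move=> x x1; have [n0 n1 _ _ /andP[l1 l2]] := ln_truncn x1.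
have : (Num.truncn x)%:R^-1 <= 1 :> R by rewrite invf_le1 //; lra.
have := hK _ n0; rewrite -/(mertens_sum x) !ler_norml => /andP[h1 h2] h3.
by have := ler_norm K; move=> h4; apply/andP; split; lra.
Qed.

Definition selberg_sum x : R := \sum_(1 <= n < (Num.truncn x).+1) Lam n * psiR (x / n%:R).

Lemma SelbergR : exists2 K : R, 0 < K & forall x, 1 <= x ->
  `|psiR x * ln x + selberg_sum x - 2 * x * ln x| <= K * x.
Proof.
have [K hK] := Selberg_nat R; have [K1 K10 hK1] := psiR_linear.
exists (`|K| + K1 + 4); first by have := normr_ge0 K; lra.
move=> x x1; have [n0 n1 n2 n3 /andP[l1 l2]] := ln_truncn x1.
have V1 : (Num.truncn x)%:R^-1 <= 1 :> R by rewrite invf_le1 //; lra.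
have := hK _ n0.
have -> : \sum_(1 <= n < (Num.truncn x).+1) Lam n * chebyshev_psi R (Num.truncn x %/ n) =
  selberg_sum x.
  by apply: eq_big_nat => n /andP[m0 _]; rewrite /psiR truncn_div_nat //; lra.
rewrite -/(psiR x) !ler_norml.
have lx := ln_ge0 x1; have lN := ln_ge0 n1.
have lx1 := @ln_le_sub1 _ x ltac:(lra).
have := hK1 x ltac:(lra); have := psiR_ge0 x.
move: (selberg_sum x) (psiR x) (ln x) (ln (Num.truncn x)%:R) l1 l2 lx lN lx1 => A P L L'.
move: ((Num.truncn x)%:R) n1 n2 n3 V1 => N n1 n2 n3 V1 l1 l2 lx lN lx1 p0 p1 /andP[h1 h2].
have q0 : 0 <= P * (L - L') <= K1 * x by apply/andP; split; [apply: mulr_ge0; lra | nra].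
have NV : N * N^-1 = 1 by rewrite divff // gt_eqF //; lra.
have q1 : 0 <= N * (L - L') <= 1.
  apply/andP; split; [apply: mulr_ge0; lra | rewrite -NV ler_pM2l; lra].
have q2 : 0 <= (x - N) * L <= x by apply/andP; split; [apply: mulr_ge0; lra | nra].
have q3 : K * N <= `|K| * x.
  by apply: le_trans (_ : `|K| * N <= _); [rewrite ler_wpM2r ?ler_norm //;
    lra | rewrite ler_wpM2l //].
by apply/andP; split; nra.
Qed.

Lemma selberg_sum_homo z s : 0 <= z <= s -> selberg_sum z <= selberg_sum s.
Proof.
case/andP=> z0 zs; rewrite /selberg_sum [X in _ <= X](big_cat_nat (n := (Num.truncn z).+1)) //=;
  last first.
  by rewrite ltnS le_truncn.
rewrite -[X in X <= _]addr0; apply: lerD.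
  apply: ler_sum => n _; rewrite ler_wpM2l ?vonMangoldt_ge0 //.
  by apply: psiR_homo; rewrite ler_wpM2r // invr_ge0.
by apply: sumr_ge0 => n _; rewrite mulr_ge0 ?vonMangoldt_ge0 ?psiR_ge0.
Qed.

(** Subtract Selberg's formula at z from the one at s and drop the increase of [selberg_sum]. The
    errors K s + K z and 2 z (ln s - ln z) amount to at most (2 K + 2) s, which is below e s ln s
    once ln s >= Q. *)
Lemma psiR_increment (e Y1 : R) : 0 < e -> exists Y : R, [/\ 1 <= Y, Y1 <= Y &
  forall z s, Y <= z -> z <= s -> psiR s - psiR z <= 2 * (s - z) + e * s].
Proof.
move=> e0; have [K K0 hK] := SelbergR.
pose Q := (2 * K + 2) / e; have Q0 : 0 < Q by rewrite divr_gt0 //; lra.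
have eQE : e * Q = 2 * K + 2 by rewrite /Q mulrCA divff ?mulr1 // gt_eqF.
clearbody Q.
exists (1 + `|Y1| + expR Q).
have y0 := normr_ge0 Y1; have y1 := ler_norm Y1; have eQ := expR_gt0 Q.
split; try lra; move=> z s Yz zs.
have z1 : 1 <= z by lra.
have s1 : 1 <= s by lra.
have lsQ : Q <= ln s by rewrite -(expRK Q) ler_ln ?posrE //; lra.
have ls0 : 0 < ln s by lra.
have lzs : ln z <= ln s by rewrite ler_ln ?posrE //; lra.
have lz := ln_ge0 z1.
have lsz : z * (ln s - ln z) <= s - z.
  rewrite -ln_div ?posrE; try lra.
  apply: le_trans (ler_wpM2l _ (ln_le_sub1 _)) _; try lra; first by rewrite divr_gt0; lra.
  by rewrite mulrBr mulr1 mulrCA divff ?gt_eqF; lra.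
have := hK z z1; have := hK s s1; rewrite !ler_norml => /andP[_ h1] /andP[h2 _].
have h3 := selberg_sum_homo (z := z) (s := s) ltac:(lra).
have p0 := psiR_ge0 z.
have es : (2 * K + 2) * s <= e * s * ln s.
  rewrite -eQE; have q : Q * s <= ln s * s by rewrite ler_pM2r //; lra.
  by have := ler_wpM2l (ltW e0) q; lra.
have key : (psiR s - psiR z) * ln s <= (2 * (s - z) + e * s) * ln s.
  move: (selberg_sum s) (selberg_sum z) (psiR s) (psiR z) (ln s) (ln z) h1 h2 h3 p0 es lsz lzs lz
    {lsQ ls0} => A B P P' L L' *; nra.
by rewrite ler_pM2r in key.
Qed.

Lemma psiR_sum x y : 0 <= x <= y -> psiR y - psiR x =
  \sum_((Num.truncn x).+1 <= n < (Num.truncn y).+1) Lam n.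
Proof.
case/andP=> x0 xy; rewrite /psiR /chebyshev_psi [X in X - _](big_cat_nat (n := (Num.truncn x).+1))
  //=.
  by rewrite addrAC subrr add0r.
by rewrite ltnS le_truncn.
Qed.

(* How far (x / n, r x / n] falls short of the maximal density 2 of [psiR_increment]. *)
Definition deficit (r e x : R) n : R :=
  2 * (r - 1) * x / n%:R + e * r * x / n%:R - (psiR (r * x / n%:R) - psiR (x / n%:R)).

(** Across a near-gap the psi terms of Selberg's formula hardly change, so [selberg_sum] must grow
    by almost 2 (r - 1) x ln x. By Mertens this is also what maximal density on every (x / n, r x /
    n] would give, so the weighted deficits sum to O(e x ln x). They are nonnegative as long as x /
    n >= Y. *)
Lemma near_gap_deficit (r e Y1 : R) : 1 < r <= 12 -> 0 < e ->
  exists Y X0 : R, [/\ 1 <= Y, Y1 <= Y, Y <= X0,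
    (forall z s, Y <= z -> z <= s -> psiR s - psiR z <= 2 * (s - z) + e * s) &
    forall x, X0 <= x -> psiR (r * x) - psiR x <= e * x ->
      (forall n, (0 < n <= Num.truncn (x / Y))%N -> 0 <= deficit r e x n) /\
      \sum_(1 <= n < (Num.truncn (x / Y)).+1) Lam n * deficit r e x n <= 30 * e * x * ln x].
Proof.
move=> /andP[r1 r12] e0.
have [Y [Y1' YY1 hY]] := psiR_increment Y1 e0.
have Y0 : 0 < Y by lra.
have r0 : 0 < r by lra.
have [K K0 hK] := SelbergR; have [K1 K10 hK1] := psiR_linear; have [K2 K20 hK2] := MertensR.
have lr : 0 <= ln r by apply: ln_ge0; lra.
have lY : 0 <= ln Y by apply: ln_ge0.
(* All error terms of order x; the choice of X0 makes K3 x at most e x ln x. *)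
pose K3 := (2 * r + e * r) * K2 + 2 * K * r + K1 * ln r + e * ln r + K1 * r * (ln r + ln Y + 2 *
  K2).
have K30 : 0 <= K3 by rewrite /K3 !addr_ge0 ?mulr_ge0 ?addr_ge0 ?mulr_ge0 //; lra.
exists Y, (Y + expR (K3 / e)); have eK := expR_gt0 (K3 / e).
split => //; first lra; move=> x Xx gap.
have x1 : 1 <= x by lra.
have x0 : 0 < x by lra.
have lx : K3 / e <= ln x by rewrite -(expRK (K3 / e)) ler_ln ?posrE //; lra.
have lx0 : 0 <= ln x by apply: ln_ge0.
pose X := r * x; have X1 : 1 <= X by rewrite /X; nra.
have xX : x <= X by rewrite /X; nra.
have lX : ln X = ln r + ln x by rewrite lnM ?posrE //; lra.
have Dge0 n : (0 < n <= Num.truncn (x / Y))%N -> 0 <= deficit r e x n.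
  case/andP=> n0 nQ; have nR : 0 < n%:R :> R by rewrite ltr0n.
  have nx : n%:R <= x / Y by rewrite -truncn_ge_nat // divr_ge0 // ltW.
  have Yn : Y <= x / n%:R by move: nx; rewrite !ler_pdivlMr // mulrC.
  have := hY (x / n%:R) (r * x / n%:R) Yn; rewrite /deficit -mulrA.
  have y0 : 0 <= x / n%:R by rewrite divr_ge0 // ltW.
  move=> /(_ ltac:(nra)); rewrite -!mulrA; move: (x / n%:R) => w; nra.
split => //.
set Q := Num.truncn (x / Y).
pose g n : R := psiR (X / n%:R) - psiR (x / n%:R).
have QX : (Q <= Num.truncn X)%N.
  by apply: le_truncn; apply: le_trans xX; rewrite ler_pdivrMr; nra.
have AE : selberg_sum X - selberg_sum x = \sum_(1 <= n < Q.+1) Lam n * g n +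
     \sum_(Q.+1 <= n < (Num.truncn X).+1) Lam n * g n.
  rewrite -(big_cat_nat (n := Q.+1)) //=.
  have -> : selberg_sum x = \sum_(1 <= n < (Num.truncn X).+1) Lam n * psiR (x / n%:R).
    rewrite [RHS](big_cat_nat (n := (Num.truncn x).+1)) //=; last by rewrite ltnS le_truncn.
    rewrite [X in _ = _ + X]big_nat_cond [X in _ = _ + X]big1 ?addr0 // => n /andP[/andP[n1 _] _].
    have nR : 0 < n%:R :> R by rewrite ltr0n; exact: leq_ltn_trans (leq0n _) n1.
    have -> : psiR (x / n%:R) = 0; last by rewrite mulr0.
    apply: psiR_lt1; rewrite ltr_pdivrMr //.
    by rewrite mul1r; apply: lt_le_trans (truncnS_gt x) _; rewrite ler_nat.
  by rewrite /selberg_sum -sumrB; apply: eq_bigr => n _; rewrite /g mulrBr.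
have xY : 1 <= x / Y by rewrite ler_pdivlMr // mul1r; lra.
have lxY : ln (x / Y) = ln x - ln Y by rewrite ln_div ?posrE.
have tail : \sum_(Q.+1 <= n < (Num.truncn X).+1) Lam n * g n <= K1 * X * (ln r + ln Y + 2 * K2).
  apply: le_trans (_ : \sum_(Q.+1 <= n < (Num.truncn X).+1) K1 * X * (Lam n / n%:R) <= _).
    apply: ler_sum_nat => n /andP[n1 _]; rewrite mulrCA ler_wpM2l ?vonMangoldt_ge0 //.
    rewrite /g; apply: le_trans (_ : psiR (X / n%:R) <= _); first by have := psiR_ge0 (x / n%:R);
      lra.
    by rewrite -(mulrA K1 X); apply: hK1; apply: divr_ge0 => //; lra.
  rewrite -mulr_sumr ler_wpM2l //; first by rewrite mulr_ge0 ?ltW // (lt_le_trans x0).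
  have -> : \sum_(Q.+1 <= n < (Num.truncn X).+1) Lam n / n%:R = mertens_sum X - mertens_sum (x / Y).
    by rewrite /mertens_sum -/Q [X in X - _](big_cat_nat (n := Q.+1)) //= addrAC subrr add0r.
  have := hK2 X X1; have := hK2 (x / Y) xY; rewrite !ler_norml lX lxY; lra.
have W : mertens_sum (x / Y) <= ln x + K2.
  by have := hK2 (x / Y) xY; rewrite !ler_norml lxY; lra.
have -> : \sum_(1 <= n < Q.+1) Lam n * deficit r e x n =
   (2 * (X - x) + e * X) * mertens_sum (x / Y) - \sum_(1 <= n < Q.+1) Lam n * g n.
  rewrite /mertens_sum -/Q mulr_sumr -sumrB; apply: eq_bigr => n _.
  by rewrite /deficit /g /X; ring.
have := hK X X1; have := hK x x1; rewrite !ler_norml => /andP[_ s1] /andP[s2 _].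
have px := hK1 x ltac:(lra); have px0 := psiR_ge0 x.
have W' : (2 * (X - x) + e * X) * mertens_sum (x / Y) <= (2 * (X - x) + e * X) * (ln x + K2).
  by rewrite ler_wpM2l //; have : 0 <= e * X by [apply: mulr_ge0; lra]; lra.
have gap' : psiR X * ln X <= psiR x * ln X + e * x * ln X.
  rewrite -mulrDl ler_wpM2r //; first by rewrite lX; lra.
  by rewrite -/X in gap; lra.
have ex : K3 * x <= e * x * ln x.
  rewrite ler_pdivrMr // in lx; rewrite [e * x * _]mulrAC [e * ln x]mulrC.
  by rewrite ler_pM2r.
have pl : psiR x * ln r <= K1 * x * ln r by rewrite ler_wpM2r.
have h0 : 0 <= e * x * ln x by rewrite !mulr_ge0 // ltW.
have XX : e * X * ln x <= 12 * (e * x * ln x).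
  have -> : e * X * ln x = r * (e * x * ln x) by rewrite /X; ring.
  by rewrite ler_wpM2r.
have sub : \sum_(1 <= n < Q.+1) Lam n * g n >= selberg_sum X - selberg_sum x - K1 * X * (ln r + ln
  Y + 2 * K2).
  by rewrite AE; lra.
have K3E : K3 * x = (2 * X + e * X) * K2 + 2 * K * X + K1 * x * ln r + e * x * ln r + K1 * X * (ln
  r + ln Y + 2 * K2).
  by rewrite /K3 /X; ring.
have xK : 0 <= K * (X - x) by rewrite mulr_ge0 ?subr_ge0 // ltW.
have xK2 : 0 <= x * K2 by rewrite mulr_ge0 // ltW.
have XL : 0 <= (X - x) * ln r by rewrite mulr_ge0 ?subr_ge0.
have xL : 0 <= x * ln r by rewrite mulr_ge0 // ltW.
rewrite lX in s2 gap'.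
move: (selberg_sum X) (selberg_sum x) (mertens_sum _) (\sum_(1 <= n < Q.+1) _) (psiR X) (psiR x)
  (ln x) (ln r) (ln Y)
  sub W' s1 s2 gap' K3E ex pl XX h0 lx0 lr XL xL px px0 => SX Sx Ls Sg PX Px L l lY' sub W' s1 s2
    gap'.
move=> K3E ex pl XX h0 lx0 lr' XL xL px px0.
clear AE tail W lx gap g Dge0; clearbody X K3; lra.
Qed.

(** The J - j0 windows (a ^ j, a ^ (j + 1)] are disjoint and lie below Q, so one of them carries at
    most the average. *)
Lemma window_pigeonhole (f : nat -> R) (a j0 J Q : nat) (S : R) :
  (1 < a)%N -> (j0 < J)%N -> (a ^ J <= Q)%N ->
  (forall n, (0 < n <= Q)%N -> 0 <= f n) ->
  \sum_(1 <= n < Q.+1) f n <= S ->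
  exists j, [/\ (j0 <= j < J)%N &
    (J - j0)%:R * \sum_((a ^ j).+1 <= n < (a ^ j.+1).+1) f n <= S].
Proof.
move=> a1 jJ aQ f0 fS; apply/not_existsP => hn.
have aj j k : (j <= k)%N -> (a ^ j <= a ^ k)%N by move=> jk; rewrite leq_exp2l.
have tot k : (j0 <= k)%N -> \sum_(j0 <= j < k) \sum_((a ^ j).+1 <= n < (a ^ j.+1).+1) f n =
   \sum_((a ^ j0).+1 <= n < (a ^ k).+1) f n.
  elim: k => [|k IH]; first by rewrite leqn0 => /eqP ->; rewrite !big_geq.
  rewrite leq_eqVlt => /orP[/eqP <-|jk]; first by rewrite !big_geq.
  rewrite big_nat_recr //= IH // -big_cat_nat //= ltnS aj //.
have D0 : 0 < (J - j0)%:R :> R by rewrite ltr0n subn_gt0.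
have lt : S < \sum_(j0 <= j < J) \sum_((a ^ j).+1 <= n < (a ^ j.+1).+1) f n.
  have -> : S = \sum_(j0 <= j < J) S / (J - j0)%:R.
    by rewrite sumr_const_nat -[RHS]mulr_natr divfK ?gt_eqF.
  apply: ltr_sum_nat => // j /andP[jj jJ'].
  rewrite ltr_pdivrMr // ltNge mulrC; apply/negP => h.
  by apply: (hn j); split => //; rewrite jj.
move: lt; rewrite ltNge => /negP; apply; rewrite tot ?(ltnW jJ) //.
apply: le_trans fS; rewrite [X in _ <= X](big_cat_nat (n := (a ^ j0).+1)) //=; last first.
  by rewrite ltnS (leq_trans _ aQ) // aj // ltnW.
rewrite [X in _ <= _ + X](big_cat_nat (n := (a ^ J).+1)) //= ?ltnS ?aj ?(ltnW jJ) //.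
rewrite addrCA lerDl addr_ge0 // big_nat_cond sumr_ge0 // => n /andP[/andP[n1 n2] _]; apply: f0.
  by rewrite ltnS in n2; rewrite n1 /=; apply: leq_trans n2 _; apply: leq_trans aQ; apply/aj/ltnW.
by rewrite ltnS in n2; rewrite n2 andbT; exact: leq_ltn_trans (leq0n _) n1.
Qed.

(* If z <= s, the block (z, r z] prolongs the part already covered; if z > s, only the short
   interval (s, z] is lost. *)
Lemma chained_covering (P : R -> R) (r rho h eta e k S0 B Y : R) :
  (forall x y, x <= y -> P x <= P y) ->
  1 < r -> 0 < h -> 1 + h <= r -> 1 <= rho -> 0 < S0 -> S0 <= B -> 0 <= e -> 0 <= eta -> 0 <= k <=
    2 ->
  eta + e <= k * h -> 2 * (rho - 1) + eta <= k * (r - 1) ->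
  Y <= S0 * (1 + h) / r ->
  (forall z s, Y <= z -> z <= s -> P s - P z <= 2 * (s - z) + e * s) ->
  (forall s, S0 <= s <= B -> exists z, [/\ s * (1 + h) / r <= z, z <= rho * s &
     (2 * (r - 1) - eta) * z <= P (r * z) - P z]) ->
  exists s, [/\ B < s, s <= r * rho * B & (2 - k) * (s - S0) <= P s - P S0].
Proof.
move=> Pm r1 h0 hr rho1 S00 S0B e0 eta0 k0 c1 c2 YS0 hU hG.
(* Every step moves s to r z >= (1 + h) s, a gain of at least h S0, so finitely many steps pass
   B. *)
have step m : exists s, [/\ S0 <= s, s <= r * rho * B,
    (2 - k) * (s - S0) <= P s - P S0 & B < s \/ S0 + m%:R * (h * S0) <= s].
  elim: m => [|m [s [s0 sB sP [sb|sm]]]].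
  - exists S0; split=> //; last by right; rewrite mul0r addr0.
      have : 1 <= r * rho by nra.
      by move: (r * rho) => q; nra.
    by rewrite !subrr mulr0.
  - by exists s; split=> //; left.
  have [sb|sb] := ltP B s; first by exists s; split=> //; left.
  have [z [z1 z2 z3]] := hG s ltac:(lra).
  have z1' : s * (1 + h) <= r * z.
    by move: z1; rewrite ler_pdivrMr //; lra.
  have sp : 0 < s by lra.
  have zp : 0 < z by apply: lt_le_trans z1; rewrite divr_gt0 ?mulr_gt0; lra.
  have rzB : r * z <= r * rho * B.
    by rewrite -mulrA ler_pM2l; [apply: le_trans z2 _; rewrite ler_pM2l; lra | lra].
  have S0s : h * S0 <= h * s by rewrite ler_pM2l.
  exists (r * z); split => //; first by nra.
  (* When z <= s, [hU] bounds the part of the block on (z, s], and c1 pays the errors out of the new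
     length r z - s >= h s. When z > s, the skipped length is at most (rho - 1) z, paid by c2. *)
  - have [zs|zs] := leP z s.
      have := hU z s; move=> /(_ _ zs) U.
      have {}U := U ltac:(apply: le_trans YS0 _; apply: le_trans z1;
        rewrite ler_pM2r ?invr_gt0 ?ler_pM2r; lra).
      have hs : h * s <= r * z - s by lra.
      have ee : (eta + e) * s <= k * (r * z - s).
        apply: le_trans (_ : k * h * s <= _); first by rewrite ler_wpM2r //; lra.
        by rewrite -mulrA ler_wpM2l; lra.
      have : eta * z <= eta * s by rewrite ler_wpM2l.
      by move: (P (r * z)) (P s) (P z) (P S0) z3 U sP => A1 A2 A3 A4; nra.
    have := Pm s z (ltW zs) => Psz.
    have a1 : rho * s <= s + (rho - 1) * z by nra.
    have a2 : (2 - k) * (r * z - s) <= (2 - k) * (((r - 1) + (rho - 1)) * z).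
      by rewrite ler_wpM2l; nra.
    have a3 : (2 - k) * (((r - 1) + (rho - 1)) * z) <= (2 * (r - 1) - eta) * z.
      by rewrite mulrA ler_pM2r //; nra.
    by move: (P (r * z)) (P s) (P z) (P S0) z3 Psz sP => A1 A2 A3 A4; nra.
  right; rewrite -natr1; nra.
pose m := (Num.truncn (B / (h * S0))).+1.
have [s [s0 sB sP sb]] := step m.
exists s; split=> //; case: sb => // sb.
have hS : 0 < h * S0 by rewrite mulr_gt0.
have : B / (h * S0) < m%:R by apply: truncnS_gt.
by rewrite ltr_pdivrMr //; lra.
Qed.

End ErdosGaps.

(** * Near-gaps at an almost extremal ratio *)

Section PrimePowerGaps.
Variable R : realType.
Implicit Types (n k N M : nat) (x y z s : R).
Local Notation Lam := (@vonMangoldt R).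
Local Notation psiR := (@psiR R).

(** Small mass is asked for, not an empty interval, so that the failure of the property at a larger
    ratio supplies a positive density of prime powers in all intervals of that ratio. *)
Definition near_gaps (c : R) : Prop := 0 <= c /\
  forall d X : R, 0 < d -> exists2 x, X <= x & psiR ((1 + c) * x) - psiR x <= d * x.

(** Chebyshev's bounds: for c > 10 the lower bound (2 / 5) (1 + c) x exceeds (8 / 5) x by a multiple
    of x. *)
Lemma near_gaps_le (c : R) : near_gaps c -> c <= 10.
Proof.
move=> [c0 hc]; have [K1 h1] := psiR_upper R; have [K2 h2] := psiR_lower R.
have [x xX gap] := hc (1 / 10) (10 * (`|K1| + `|K2| + 1)) ltac:(lra).
have := ler_norm K1; have := ler_norm K2; have := normr_ge0 K1; have := normr_ge0 K2 => *.
have x0 : 0 < x by lra.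
have := h1 x ltac:(lra); have := h2 ((1 + c) * x) ltac:(nra) => *.
rewrite leNgt; apply/negP => c10.
have : 10 * x < c * x by rewrite ltr_pM2r.
by lra.
Qed.

(** Were there no such n in (y, r' y], each n there would have deficit above eta x / (r' y); the
    prime powers in the interval weigh more than d' y, so the window would already exceed eta d' x /
    r'. *)
Lemma good_points (r r' e eta d' x Y X' : R) (a j : nat) :
  1 < r -> 1 < r' -> 0 < e -> 0 < eta -> 0 < d' -> 0 < x -> 1 <= Y -> 
  (1 < a)%N -> X' <= (a ^ j)%:R :> R -> (a ^ j.+1 <= Num.truncn (x / Y))%N ->
  (forall y, X' <= y -> d' * y < psiR (r' * y) - psiR y) ->
  (forall n, (0 < n <= Num.truncn (x / Y))%N -> 0 <= deficit r e x n) ->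
  \sum_((a ^ j).+1 <= n < (a ^ j.+1).+1) Lam n * deficit r e x n < eta * d' * x / r' ->
  forall y, (a ^ j)%:R <= y -> r' * y <= (a ^ j.+1)%:R ->
    exists2 n : nat, y < n%:R <= r' * y &
      (2 * (r - 1) - eta) * (x / n%:R) <= psiR (r * (x / n%:R)) - psiR (x / n%:R).
Proof.
move=> r1 r'1 e0 eta0 d0 x0 Y1 a1 Xj ajQ hd D0 Dsum y jy yj.
have ajp : (0 < a ^ j)%N by rewrite expn_gt0 (ltnW a1).
have y0 : 0 < y by apply: lt_le_trans jy; rewrite ltr0n.
have yr : y <= r' * y by nra.
apply: contrapT => hn.
have lo n : (Num.truncn y < n)%N -> (n < (Num.truncn (r' * y)).+1)%N -> eta * x / n%:R < deficit r
  e x n.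
  move=> n1 n2; have n0 : 0 < n%:R :> R by rewrite ltr0n; exact: leq_ltn_trans (leq0n _) n1.
  rewrite ltNge; apply/negP => Dn; apply: hn; exists n.
    rewrite ltnS truncn_ge_nat in n2; last by lra.
    by rewrite n2 andbT; apply: lt_le_trans (truncnS_gt y) _; rewrite ler_nat.
  move: Dn; rewrite /deficit !mulrA.
  have : 0 <= e * r * x / n%:R by rewrite divr_ge0 ?mulr_ge0 //; lra.
  by move: (psiR _) (psiR _) => P P'; lra.
have jt : (a ^ j <= Num.truncn y)%N by rewrite truncn_ge_nat // ltW.
have tj : (Num.truncn (r' * y) <= a ^ j.+1)%N.
  rewrite truncn_le_nat; apply: le_lt_trans yj _; rewrite ltr_nat ltnS //.
have tt : (Num.truncn y <= Num.truncn (r' * y))%N by apply: le_truncn.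
move: Dsum; apply/negP; rewrite -leNgt.
apply: le_trans (_ : \sum_((Num.truncn y).+1 <= n < (Num.truncn (r' * y)).+1) Lam n * deficit r e x
  n <= _); last first.
  rewrite [X in _ <= X](big_cat_nat (n := (Num.truncn y).+1)) //=; last first.
    by rewrite ltnS; apply: leq_trans tt tj.
  rewrite [X in _ <= _ + X](big_cat_nat (n := (Num.truncn (r' * y)).+1)) //=.
  rewrite addrCA lerDl addr_ge0 // big_nat_cond sumr_ge0 // => n /andP[/andP[n1 n2] _];
    rewrite mulr_ge0 ?vonMangoldt_ge0 //; apply: D0; rewrite (leq_ltn_trans (leq0n _) n1) /=.
    by apply: leq_trans ajQ; apply: leq_trans tj; apply: leq_trans tt; rewrite -ltnS.
  by apply: leq_trans ajQ; rewrite -ltnS.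
apply: le_trans (_ : eta * x / (r' * y) * (psiR (r' * y) - psiR y) <= _).
  have h := hd y (le_trans Xj jy).
  have -> : eta * d' * x / r' = eta * x / (r' * y) * (d' * y).
    by field; rewrite !gt_eqF //; lra.
  by rewrite ler_wpM2l ?(ltW h) // divr_ge0 ?mulr_ge0; lra.
rewrite psiR_sum; last by rewrite yr (ltW y0).
rewrite mulr_sumr; apply: ler_sum_nat => n /andP[n1 n2].
rewrite mulrC ler_wpM2l ?vonMangoldt_ge0 //; apply/ltW; apply: le_lt_trans (lo n n1 n2).
have n0 : 0 < n%:R :> R by rewrite ltr0n; exact: leq_ltn_trans (leq0n _) n1.
rewrite ler_wpM2l //; first by rewrite mulr_ge0; lra.
rewrite lef_pV2 ?posrE //; last by lra.
by rewrite ltnS truncn_ge_nat in n2; lra.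
Qed.

(** [chained_covering] with k = 1 / 10 gives density 19 / 10 from r' M up to some s >= 10 r' M.
    Hence psi s >= 1.9 * 0.9 s = 1.71 s, which is more than 1.6 s + Kp. *)
Lemma full_density_absurd (r r' rho h eta e Y M A N x Kp : R) :
  0 < h -> 1 + 100 * h <= r -> 1 < r' -> rho * r = (1 + h) * r' -> 1 <= rho -> rho <= 1 + 4 * h ->
  eta * 20 = h -> 0 <= e -> e <= eta -> 10 * r' * rho <= A -> 1 <= Y -> 10 * `|Kp| + 1 <= Y ->
  (forall s, 0 <= s -> psiR s <= 8 / 5 * s + Kp) ->
  (forall z s, Y <= z -> z <= s -> psiR s - psiR z <= 2 * (s - z) + e * s) ->
  0 < N -> 0 < x -> M * (A * N) = x -> Y <= M ->
  (forall y, N <= y -> r' * y <= A * N -> exists2 n : nat, y < n%:R <= r' * y &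
      (2 * (r - 1) - eta) * (x / n%:R) <= psiR (r * (x / n%:R)) - psiR (x / n%:R)) ->
  False.
Proof.
move=> h0 r1 r'1 rhor rho1 rho4 etah e0 e1 aR Y1 YY1 hKp hU N0 x0 MaN YM good.
have M0 : 0 < M by lra.
have r'0 : 0 < r' by lra.
have rho0 : 0 < rho by lra.
have r0 : 0 < r by lra.
have A0 : 0 < A by apply: lt_le_trans aR; rewrite !mulr_gt0.
have aN0 : 0 < A * N by rewrite mulr_gt0.
have [s [s1 s2 s3]] : exists s, [/\ A * M / rho < s, s <= r * rho * (A * M / rho) &
    (2 - 1 / 10) * (s - r' * M) <= psiR s - psiR (r' * M)].
  apply: (@chained_covering R psiR r rho h eta e (1 / 10) (r' * M) (A * M / rho) Y) => //; try lra.
  - exact: psiR_homo.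
  - by rewrite mulr_gt0.
  - rewrite ler_pdivlMr; last by lra.
    have : 10 * r' * rho * M <= A * M by rewrite ler_pM2r.
    have : 0 <= r' * M * rho by rewrite !mulr_ge0 //; lra.
    lra.
  - apply: le_trans YM _; rewrite ler_pdivlMr; last by lra.
    have -> : r' * M * (1 + h) = M * (rho * r) by rewrite rhor; ring.
    by rewrite ler_pM2l //; nra.
  - move=> s /andP[s1 s2].
    have s0 : 0 < s by apply: lt_le_trans s1; rewrite mulr_gt0.
    have rs0 : 0 < rho * s by rewrite mulr_gt0 //; lra.
    rewrite ler_pdivlMr in s2; last by lra.
    (* For y = x / (rho s), a point n in (y, r' y] puts z = x / n between rho s / r' = s (1 + h) / r
       and rho s. *)
    have [] := good (x / (rho * s)).
    + rewrite ler_pdivlMr // -MaN.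
      have -> : M * (A * N) = N * (A * M) by ring.
      by rewrite ler_pM2l //; lra.
    + rewrite mulrA ler_pdivrMr // -MaN.
      have -> : r' * (M * (A * N)) = A * N * (r' * M) by ring.
      rewrite ler_pM2l //; apply: le_trans s1 _; nra.
    move=> n /andP[n1 n2] n3.
    have n0 : 0 < n%:R :> R by apply: lt_trans n1; rewrite divr_gt0.
    exists (x / n%:R); split => //.
      rewrite ler_pdivlMr // mulrAC ler_pdivrMr; last by lra.
      move: n2; rewrite mulrA ler_pdivlMr // => n2.
      have -> : s * (1 + h) * n%:R = (n%:R * (rho * s)) * ((1 + h) / rho).
        by field; rewrite gt_eqF //; lra.
      apply: le_trans (ler_wpM2r _ n2) _; first by rewrite divr_ge0; lra.
      have -> : r' * x * ((1 + h) / rho) = x * (((1 + h) * r') / rho) by ring.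
      by rewrite -rhor mulrAC divff ?mul1r // gt_eqF //; lra.
    rewrite ler_pdivrMr //; move: n1; rewrite ltr_pdivrMr //; lra.
have s0 : 10 * (r' * M) <= s.
  apply/ltW; apply: le_lt_trans s1; rewrite ler_pdivlMr; last by lra.
  by have : 10 * r' * rho * M <= A * M by [rewrite ler_pM2r]; lra.
have sM : Y <= s by nra.
have := hKp s ltac:(lra); have := psiR_ge0 (r' * M).
have := ler_norm Kp; have := normr_ge0 Kp; lra.
Qed.

Lemma no_near_gaps (c0 : R) : 0 < c0 <= 1 -> ~ near_gaps c0.
Proof.
move=> /andP[c00 c01] hc0.
pose E := [set c | near_gaps c]%classic.
have hE : has_sup E by split; [exists c0 | exists 10 => c; exact: near_gaps_le].
have C0 : c0 <= sup E by apply: sup_upper_bound.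
have C10 : sup E <= 10 by apply: ge_sup; [exists c0 | move=> c; exact: near_gaps_le].
(* Then c > 199 h, so r - 1 dominates the losses 2 (rho - 1) + eta in the covering. *)
pose h := c0 / 200; have h0 : 0 < h by rewrite /h; lra.
have hc : h * 200 = c0 by rewrite /h; lra.
have [c [c_ge0 gapc] cC] := sup_adherent h0 hE.
have cleC : c <= sup E by apply: sup_upper_bound; rewrite //; split.
have c'E : ~ near_gaps (sup E + h).
  move=> /(sup_upper_bound hE); lra.
move: (sup E) C0 C10 cC cleC c'E {hE} => C C0 C10 cC cleC c'E; clearbody h.
have cC' : c <= 10 by apply: near_gaps_le; split.
pose r := 1 + c; pose r' := 1 + (C + h).
have r1 : 1 + 100 * h <= r by rewrite /r; lra.
have r11 : r <= 11 by rewrite /r; lra.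
have rr' : r' <= r + 2 * h by rewrite /r' /r; lra.
have r'r : 1 + h < r' by rewrite /r'; lra.
have [d' d'0 [X' hd']] : exists2 d' : R, 0 < d' & exists X', forall y, X' <= y -> d' * y < psiR (r'
  * y) - psiR y.
  apply: contrapT => hn; apply: c'E; split; first by lra.
  move=> d X d0; apply: contrapT => hn2; apply: hn; exists d => //; exists X => y Xy.
  by rewrite ltNge; apply/negP => gy; apply: hn2; exists y.
pose rho := (1 + h) * r' / r.
have rhor : rho * r = (1 + h) * r' by rewrite /rho divfK // gt_eqF //; lra.
have rho4 : rho <= 1 + 4 * h.
  rewrite /rho ler_pdivrMr; last by lra.
  apply: le_trans (_ : (1 + h) * (r + 2 * h) <= _); first by rewrite ler_pM2l //; lra.
  nra.
have rho1 : 1 <= rho.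
  rewrite /rho ler_pdivlMr; last by lra.
  have : r <= r' by rewrite /r /r'; lra.
  nra.
have r_gt1 : 1 < r by lra.
have r'_gt1 : 1 < r' by lra.
clearbody rho.
(* One window of ratio a must yield a covered interval whose ends have ratio at least 10. *)
pose a := (Num.truncn (10 * r' * rho)).+2.
have aR : 10 * r' * rho <= a%:R :> R.
  by apply/ltW; apply: lt_le_trans (truncnS_gt _) _; rewrite ler_nat.
have a1 : (1 < a)%N by [].
clearbody a.
have aR1 : 1 < a%:R :> R by rewrite ltr1n.
have la : 0 < ln a%:R :> R by rewrite ln_gt0.
pose eta := h / 20; have eta0 : 0 < eta by rewrite /eta; lra.
have etah : eta * 20 = h by rewrite /eta; lra.
clearbody eta.
(* The second bound brings the average window deficit, at most 60 e x ln a, below the threshold of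
   [good_points]. *)
pose e := Num.min eta (eta * d' / r' / (100 * ln a%:R)).
have r'0 : 0 < r' by lra.
have e0 : 0 < e by rewrite lt_min eta0 /= !(divr_gt0, mulr_gt0).
have e1 : e <= eta by rewrite ge_min lexx.
have e2 : 100 * (e * ln a%:R) <= eta * d' / r'.
  have : e <= eta * d' / r' / (100 * ln a%:R) by rewrite ge_min lexx orbT.
  by rewrite ler_pdivlMr ?mulr_gt0 //; lra.
clearbody e.
have [Kp hKp] := psiR_upper R.
have [Y [X0 [Y1 YY1 YX0 hU hgap]]] := @near_gap_deficit R r e (10 * `|Kp| + 1) ltac:(lra) e0.
have Y0 : 0 < Y by lra.
have a0 : 0 < a%:R :> R by lra.
pose j0 := (Num.truncn X').+1.
have j0X j : (j0 <= j)%N -> X' <= (a ^ j)%:R :> R.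
  move=> jj; apply/ltW; apply: lt_le_trans (truncnS_gt X') _; rewrite ler_nat -/j0.
  by apply: leq_trans jj _; apply/ltnW/ltn_expl.
clearbody j0.
(* For ln x >= Z, discarding the windows below j0 and those near x / Y still leaves half of the
   logarithmic scale, see [JJ]. *)
pose Z := 2 * (ln Y + (j0 + 3)%:R * ln a%:R).
have [x xX gap] := gapc e (X0 + expR Z) e0.
have eZ := expR_gt0 Z.
have x0 : 0 < x by lra.
have lxZ : Z <= ln x by rewrite -(expRK Z) ler_ln ?posrE //; lra.
have [D0 Dsum] := hgap x ltac:(lra) gap.
set Q := Num.truncn (x / Y) in D0 Dsum.
have xY1 : 1 <= x / Y by rewrite ler_pdivlMr; lra.
have Q0 : (0 < Q)%N by rewrite truncn_gt0.
pose J := trunc_log a Q.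
have /andP[J1 J2] := trunc_log_bounds a1 Q0; rewrite -/J in J1 J2.
have lJ : ln x - ln Y <= (J + 1)%:R * ln a%:R.
  rewrite -ln_div ?posrE // mulr_natl -lnXn // ler_ln ?posrE ?exprn_gt0 ?divr_gt0 //.
  apply/ltW; apply: lt_le_trans (truncnS_gt _) _; rewrite -/Q -natrX ler_nat addn1 //.
have JJ : ln x / 2 <= (J%:R - j0%:R - 2) * ln a%:R.
  move: lJ lxZ; rewrite /Z !natrD; lra.
have lx0 : 0 < ln x.
  have : 0 <= ln Y by apply: ln_ge0.
  have : 0 <= j0%:R * ln a%:R :> R by rewrite mulr_ge0 //; lra.
  by move: lxZ; rewrite /Z natrD mulrDl; lra.
have jJ : (j0 < J)%N.
  rewrite -(ltr_nat R) -subr_gt0.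
  have : 0 < (J%:R - j0%:R - 2) * ln a%:R :> R by lra.
  by rewrite pmulr_lgt0 //; lra.
have f0 n : (0 < n <= Q)%N -> 0 <= Lam n * deficit r e x n.
  by move=> nQ; rewrite mulr_ge0 ?vonMangoldt_ge0 // D0.
have [j [/andP[j1 j2] jsum]] := window_pigeonhole a1 jJ J1 f0 Dsum.
have jsum' : \sum_((a ^ j).+1 <= n < (a ^ j.+1).+1) Lam n * deficit r e x n < eta * d' * x / r'.
  move: jsum; rewrite natrB ?(ltnW jJ) //; set W := \sum_(_ <= _ < _) _ => jsum.
  have W0 : 0 <= W.
    rewrite /W big_nat_cond sumr_ge0 // => n /andP[/andP[n1 n2] _]; apply: f0.
    rewrite (leq_ltn_trans (leq0n _) n1) /=; rewrite ltnS in n2; apply: leq_trans n2 _.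
    by apply: leq_trans J1; rewrite leq_exp2l.
  have p : 0 < J%:R - j0%:R :> R by rewrite subr_gt0 ltr_nat.
  have q : ln x / 2 * W <= (J%:R - j0%:R) * ln a%:R * W.
    by rewrite ler_wpM2r //; apply: le_trans JJ _; rewrite ler_pM2r //; lra.
  have q2 : ln x / 2 * W <= 30 * e * x * ln x * ln a%:R.
    by apply: le_trans q _; rewrite mulrAC ler_pM2r.
  have q3 : W <= 60 * (e * ln a%:R) * x.
    rewrite -(ler_pM2l lx0); lra.
  apply: le_lt_trans q3 _.
  have -> : eta * d' * x / r' = eta * d' / r' * x by rewrite mulrAC.
  rewrite ltr_pM2r //; apply: lt_le_trans e2; rewrite ltr_pM2r //; last by rewrite mulr_gt0.
  by lra.
have ajQ : (a ^ j.+1 <= Q)%N by apply: leq_trans J1; rewrite leq_exp2l.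
have good := @good_points r r' e eta d' x Y X' a j r_gt1 r'_gt1 e0 eta0 d'0 x0 Y1 a1 (j0X j j1) ajQ
  hd' D0 jsum'.
set N := (a ^ j)%:R : R in good.
have N0 : 0 < N by rewrite ltr0n expn_gt0 (ltnW a1).
have aN : (a ^ j.+1)%:R = a%:R * N by rewrite expnS natrM.
rewrite aN in good.
pose M := x / (a%:R * N).
have aN0 : 0 < a%:R * N by rewrite mulr_gt0 //; lra.
have MaN : M * (a%:R * N) = x by rewrite /M divfK // gt_eqF.
have YM : Y <= M.
  rewrite /M ler_pdivlMr // -aN mulrC -ler_pdivlMr //.
  by rewrite -truncn_ge_nat // divr_ge0 // ltW.
apply: (@full_density_absurd r r' rho h eta e Y M a%:R N x Kp) => //; exact: ltW.
Qed.

(** Since near-gaps are impossible, psi increases across the interval, so some n in it has [Lam n]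
    nonzero. The ratio is first cut down to c1 <= 1 to fit [no_near_gaps]. *)
Lemma prime_power_in_short_interval (c : R) : 0 < c ->
  exists X : R, forall x, X <= x ->
    exists p k, [/\ prime p, (0 < k)%N & x < (p ^ k)%:R <= (1 + c) * x].
Proof.
move=> c0; pose c1 := Num.min c 1.
have c10 : 0 < c1 <= 1 by rewrite lt_min c0 ltr01 ge_min lexx orbT.
have c1c : c1 <= c by rewrite ge_min lexx.
have [d [X [d0 hX]]] : exists d X : R, 0 < d /\ forall x, X <= x -> d * x < psiR ((1 + c1) * x) -
  psiR x.
  apply: contrapT => hn; apply: (no_near_gaps c10); split; first by lra.
  move=> d X d0; apply: contrapT => hn2; apply: hn; exists d, X; split=> // y Xy.
  by rewrite ltNge; apply/negP => gy; apply: hn2; exists y.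
exists (Num.max X 1) => x; rewrite ge_max => /andP[Xx x1].
have h := hX x Xx; have xx : 0 <= x <= (1 + c1) * x by nra.
apply: contrapT => hn.
suff : psiR ((1 + c1) * x) - psiR x <= 0.
  have : 0 < d * x by rewrite mulr_gt0 //; lra.
  by lra.
rewrite psiR_sum // big_nat_cond sumr_le0 // => n /andP[/andP[n1 n2] _].
have [->//|] := eqVneq (Lam n) 0 => /vonMangoldt_neq0[p [k [pp k0 nE]]].
exfalso; apply: hn; exists p, k; split=> //; rewrite -nE.
rewrite ltnS truncn_ge_nat in n2; last by lra.
apply/andP; split; first by apply: lt_le_trans (truncnS_gt x) _; rewrite ler_nat.
by apply: le_trans n2 _; nra.
Qed.

End PrimePowerGaps.

(** * The asymptotic bounds *)

Lemma ex_Berge_sq_le (n : nat) : (81 * ex_Berge 3 n 4 ^ 2 <= 8 * n ^ 3 + 4 * (4060 * (n * ex_Berge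
  3 n 4)))%N.
Proof.
have [H /andP[H3 noC] ->] : exists2 H : {set {set 'I_n}}, uniform 3 H && ~~ has_Berge_cycle 4 H &
  ex_Berge 3 n 4 = #|H|.
  have [|H HP HE] := eq_bigmax_cond (A := fun H : {set {set 'I_n}} => uniform 3 H && ~~
    has_Berge_cycle 4 H) (fun H => #|H|).
    apply/card_gt0P; exists finset.set0; rewrite unfold_in; apply/andP; split.
      by apply/forallP => e; rewrite inE.
    apply/negP => /existsP[v /existsP[e /and4P[_ _ /forallP /(_ ord0)]]].
    by rewrite inE.
  by exists H.
by have := Berge_C4_free_bound H3 noC; rewrite card_ord.
Qed.

(** As 8 / 81 < 1 / 10, a failure gives both m ^ 2 < 10 K e and e < K m, hence m < 10 K ^ 2, where m
    stands for n. *)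
Lemma ex_Berge_upper (R : realType) : exists N : nat, forall n, (N <= n)%N ->
  10 * (ex_Berge 3 n 4)%:R ^+ 2 <= n%:R ^+ 3 :> R.
Proof.
pose K := (4 * 4060)%:R : R.
exists (Num.truncn (10 * K * (81 * K + 1) + 1)).+1 => n nN; set e := (ex_Berge 3 n 4)%:R.
have K1 : 1 <= K by rewrite ler1n.
have nR : 10 * K * (81 * K + 1) + 1 <= n%:R.
  by apply/ltW; apply: lt_le_trans (truncnS_gt _) _; rewrite ler_nat.
have h : 81 * e ^+ 2 <= 8 * n%:R ^+ 3 + K * (n%:R * e).
  rewrite /K /e -!natrX -!natrM -natrD ler_nat -mulnA; exact: ex_Berge_sq_le.
clearbody K; rewrite leNgt; apply/negP => lt.
have e0 : 0 <= e by rewrite ler0n.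
move: e e0 h lt => e e0 h lt; move: (n%:R) nR h lt => m mR h lt.
have m1 : 1 <= m by nra.
have m0 : 0 < m by lra.
have h1 : m ^+ 3 < 10 * K * (m * e) by lra.
have h2 : m ^+ 2 < 10 * K * e.
  by rewrite -(ltr_pM2l m0); move: h1; rewrite !exprS expr0; lra.
have ep : 0 < e.
  rewrite lt_neqAle e0 andbT eq_sym; apply/eqP => E; move: h2; rewrite E mulr0.
  by rewrite ltNge sqr_ge0.
have h3 : e * (81 * e) < e * (K * m * 81).
  have a1 : 8 * m ^+ 3 < 80 * K * (m * e) by lra.
  by rewrite expr2 in h; lra.
rewrite ltr_pM2l // in h3.
have h4 : m * m < 10 * K * (K * m).
  rewrite -expr2; apply: lt_trans h2 _; rewrite ltr_pM2l //; lra.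
have h5 : m < 10 * K * K by rewrite -(ltr_pM2r m0); lra.
nra.
Qed.

(** Take a prime power q in (s / (1 + c), s] for s = sqrt (n / 3): then 3 q ^ 2 <= n, and q ^ 3 >=
    (1 - c) ^ 3 s ^ 3 >= (1 - 3 c) s ^ 3. *)
Lemma ex_Berge_lower (R : realType) (eps : R) : 0 < eps -> eps < 1 -> exists N : nat, forall n, (N
  <= n)%N ->
  (1 - eps) * Num.sqrt (n%:R / 3) ^+ 3 <= (ex_Berge 3 n 4)%:R.
Proof.
move=> e0 e1; pose c := eps / 3; have c0 : 0 < c by rewrite /c; lra.
have [X hX] := prime_power_in_short_interval c0.
pose Y := `|X| * (1 + c); exists (Num.truncn (3 * Y ^+ 2)).+1 => n nN.
have nY : 3 * Y ^+ 2 <= n%:R.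
  by apply/ltW; apply: lt_le_trans (truncnS_gt _) _; rewrite ler_nat.
set s := Num.sqrt (n%:R / 3).
have s2 : s ^+ 2 = n%:R / 3 by rewrite sqr_sqrtr // divr_ge0.
have s0 : 0 <= s by apply: sqrtr_ge0.
have Y0 : 0 <= Y by rewrite mulr_ge0 //; lra.
have Ys : Y <= s by rewrite -(@ler_pXn2r _ 2) ?nnegrE //; rewrite s2; lra.
have Xs : X <= s / (1 + c).
  by rewrite ler_pdivlMr; [apply: le_trans Ys; rewrite ler_pM2r ?ler_norm //; lra | lra].
have [p [k [pp k0 /andP[q1 q2]]]] := hX _ Xs.
have [F _ Fq] := pPrimePowerField pp k0.
move: q1 q2; rewrite -Fq; set q : R := #|F|%:R => q1 q2.
have q2' : q <= s by apply: le_trans q2 _; rewrite mulrC divfK // gt_eqF //; lra.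
have q0 : 0 <= q by rewrite ler0n.
have Fn : (3 * #|F| ^ 2 <= n)%N.
  rewrite -(ler_nat R) natrM natrX -/q.
  have : q ^+ 2 <= s ^+ 2 by rewrite ler_pXn2r ?nnegrE.
  by rewrite s2; lra.
apply: le_trans (_ : q ^+ 3 <= _); last first.
  by rewrite /q -natrX ler_nat; apply: ex_Berge_C4_ge.
have sq : s * (1 - c) <= q.
  apply: ltW; apply: le_lt_trans q1; rewrite ler_pdivlMr; last by lra.
  rewrite -mulrA; have : (1 - c) * (1 + c) <= 1 by nra.
  by move=> h; rewrite -[X in _ <= X]mulr1 ler_wpM2l.
have c1 : 0 <= 1 - c by rewrite /c; lra.
apply: le_trans (_ : (s * (1 - c)) ^+ 3 <= _); last by rewrite ler_pXn2r ?nnegrE // mulr_ge0.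
rewrite exprMn mulrC ler_wpM2l ?exprn_ge0 //.
have -> : eps = 3 * c by rewrite /c; lra.
rewrite !exprS expr0; nra.
Qed.

Local Open Scope classical_set_scope.

Theorem theorem1 (R : realType) :
  exists d e : nat -> R,
    [/\ d n @[n --> \oo] --> (0 : R),
        e n @[n --> \oo] --> (0 : R)
      & \forall n \near \oo,
          (1 - d n) * (n%:R `^ (3 / 2) / (3 * Num.sqrt 3)) <= (ex_Berge 3 n 4)%:R
          /\ (ex_Berge 3 n 4)%:R <= (1 + e n) * (n%:R `^ (3 / 2) / Num.sqrt 10)].
Proof.
have pow (n : nat) : n%:R `^ (3 / 2) = Num.sqrt n%:R ^+ 3 :> R.
  rewrite mulrC powRrM powR12_sqrt // -powR_mulrn ?sqrtr_ge0 //.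
pose B (n : nat) : R := n%:R `^ (3 / 2) / (3 * Num.sqrt 3).
have BE n : B n = Num.sqrt (n%:R / 3) ^+ 3.
  have s3 : Num.sqrt 3 ^+ 2 = 3 :> R by rewrite sqr_sqrtr.
  rewrite /B pow sqrtrM // sqrtrV // exprMn exprVn; congr (_ * _^-1).
  by rewrite exprS mulrC s3.
have B0 n : 0 <= B n by rewrite BE exprn_ge0 // sqrtr_ge0.
(* The least nonnegative error for which the lower bound holds where [B n] > 0, so only its limit is
   left to prove. *)
pose d n : R := Num.max 0 (1 - (ex_Berge 3 n 4)%:R / B n).
(* The upper error may be 0, because [ex_Berge_upper] holds exactly for all large n. *)
exists d, (fun=> 0); split; first last.
- have [N hN] := ex_Berge_upper R.
  exists (maxn N 1) => // n /=; rewrite geq_max => /andP[Nn n0].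
  have nR : 0 < n%:R :> R by rewrite ltr0n.
  split.
    rewrite -/(B n); have Bn : 0 < B n.
      by rewrite BE exprn_gt0 // sqrtr_gt0 divr_gt0.
    rewrite -ler_pdivlMr // lerBlDr -lerBlDl.
    by rewrite /d le_max lexx orbT.
  have h := hN n Nn; rewrite addr0 mul1r ler_pdivlMr ?sqrtr_gt0 //.
  rewrite -(@ler_pXn2r _ 2) ?nnegrE ?mulr_ge0 ?powR_ge0 ?sqrtr_ge0 //.
  rewrite exprMn sqr_sqrtr // pow exprAC sqr_sqrtr //; lra.
- exact: cvg_cst.
apply/cvgrPdist_le => eps eps0.
have [N hN] := @ex_Berge_lower R (Num.min eps (1 / 2)) ltac:(by rewrite lt_min eps0;
  lra) ltac:(by rewrite gt_min; apply/orP; right; lra).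
exists (maxn N 1) => // n /=; rewrite geq_max => /andP[Nn n0].
have Bn : 0 < B n by rewrite BE exprn_gt0 // sqrtr_gt0 divr_gt0 // ltr0n.
rewrite sub0r normrN ger0_norm; last by rewrite le_max lexx.
rewrite /d ge_max (ltW eps0) /= lerBlDr -lerBlDl ler_pdivlMr //.
apply: le_trans (hN n Nn); rewrite -BE ler_pM2r //.
by rewrite lerD2l lerN2 ge_min lexx.
Qed.
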